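(* Let $d\ge2$ and $b>0$. For a $b$-marginally bounded monotone totally-connected spin system on a $d$-dimensional cube $V\subseteq\mathbb Z^d$ with $n=|V|$, the strong spatial mixing (SSM) condition implies that the mixing time of any systematic scan dynamics $P_\phi$ (that is, for any ordering $\phi$ of $V$) is $O(\log n)$.
   Context: Spin systems: $\mathcal S=\{1,\dots,q\}$ is the set of spins, with a symmetric edge potential $K:\mathcal S\times\mathcal S\to\mathbb R\cup\{-\infty\}$ and a spin potential $U:\mathcal S\to\mathbb R$. For a finite $\Lambda\subset\mathbb Z^d$ (with the nearest-neighbour graph), $\partial\Lambda$ is the set of vertices outside $\Lambda$ adjacent to $\Lambda$. A boundary condition is an assignment $\tau:(\partial\Lambda)_\tau\to\mathcal S$ of spins to (some) vertices of $\partial\Lambda$, where $(\partial\Lambda)_\tau\subseteq\partial\Lambda$. The Gibbs distribution on $\mathcal S^\Lambda$ with boundary condition $\tau$ is proportional to $e^{-H}$, where $H(\sigma)=-\sum_{\{u,v\}\subset\Lambda,u\sim v}K(\sigma_u,\sigma_v)-\sum_{u\in\Lambda,v\in(\partial\Lambda)_\tau,u\sim v}K(\sigma_u,\tau_v)-\sum_{v\in\Lambda}U(\sigma_v)$ and $e^{-\infty}=0$ (boundary conditions are those for which this is well defined). For $B\subseteq\Lambda$, $\mu_B^\tau$ denotes the marginal on $B$ of this Gibbs distribution. The Gibbs distribution on the cube $V$, which may carry a boundary condition, is denoted $\mu$, and $\Omega$ is its support. SSM: a spin system on $\mathbb Z^d$ satisfies the strong spatial mixing condition if there exist constants $\alpha,\gamma,L>0$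 such that for every $d$-dimensional rectangle $\Lambda\subset\mathbb Z^d$ of side length between $L$ and $2L$ and every subset $B\subset\Lambda$, with any pair $(\tau,\tau')$ of boundary configurations on $\partial\Lambda$ that only differ at a vertex $u$, one has $\|\mu_B^\tau(\cdot)-\mu_B^{\tau'}(\cdot)\|_{TV}\le\gamma\cdot\exp(-\alpha\cdot\mathrm{dist}(u,B))$, where $\mathrm{dist}$ denotes graph distance and $\|\cdot\|_{TV}$ total variation distance. For $\Lambda\subseteq V$, let $\Omega_\Lambda=\{\tau\in\mathcal S^\Lambda:\mu(\sigma_\Lambda=\tau)>0\}$. $b$-marginally bounded: for every $\Lambda\subseteq V$, $\tau\in\Omega_\Lambda$, $v\in V\setminus\Lambda$ and $s\in\mathcal S$ with $\mu(\sigma_v=s\mid\sigma_\Lambda=\tau)>0$, one has $\mu(\sigma_v=s\mid\sigma_\Lambda=\tau)\ge b$. Totally-connected: for every $\Lambda\subseteq V$ and every $\tau\in\Omega_\Lambda$, the graph on $\{\xi\in\mathcal S^{V\setminus\Lambda}:\mu(\sigma_{V\setminus\Lambda}=\xi\mid\sigma_\Lambda=\tau)>0\}$ whose edges join configurations differing at exactly one vertex is connected. Monotone: there is a linear ordering of the spins at each vertex, inducing a (coordinatewise) partial order $\preceq_q$ on configurations, such that for every $\Lambda\subseteq V$ and every pair of (feasible) pinnings $\tau_1\succeq_q\tau_2$ on $V\setminus\Lambda$, the conditional distribution $\mu(\cdot\mid\sigma_{V\setminus\Lambda}=\tau_1)$ stochastically dominates $\mu(\cdot\mid\sigma_{V\setminus\Lambda}=\tau_2)$.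 Systematic scan: for an ordering $\phi=[v_1,\dots,v_n]$ of $V$, let $P_i$ be the transition matrix on $\Omega$ of the heat-bath update at $v_i$ (the spin at $v_i$ is resampled from the conditional distribution of $\mu$ at $v_i$ given the configuration on $V\setminus\{v_i\}$). The (symmetrized) systematic scan dynamics is $P_\phi=P_1P_2\cdots P_n\,P_nP_{n-1}\cdots P_1$. Mixing time: $T_{mix}(P)=\min\{t>0:\max_{x\in\Omega}\|P^t(x,\cdot)-\mu\|_{TV}\le1/4\}$. The asymptotics are as $n\to\infty$, with the spin system, $d$ and $b$ fixed.
   Formalization: SSM is required with the same α, γ for rectangles of side between l and 2l at every scale l ≥ L, not only at one fixed L, where it holds for every system (γ absorbs the decay) and the claim fails, e.g. for the low-temperature Ising model with free boundary. *)

(* Defs.v *)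
From HB Require Import structures.
From mathcomp Require Import all_boot all_order all_algebra.
From mathcomp Require Import finmap.
From mathcomp Require Import all_classical all_reals all_analysis.

Set Implicit Arguments.
Unset Strict Implicit.
Unset Printing Implicit Defensive.

Import Order.TTheory GRing.Theory Num.Theory.

Local Open Scope ring_scope.

Definition tv_dist (R : realType) (I : finType) (p p' : I -> R) : R :=
  2^-1 * \sum_i `|p i - p' i|.

Section FiniteVolume.
Variables (R : realType) (T : finType) (q : nat).

Notation config := {ffun T -> 'I_q}.
(* S^A for a set A of vertices *)
Definition pinning (A : {set T}) := {ffun {v : T | v \in A} -> 'I_q}.
Definition restr (A : {set T}) (sigma : config) : pinning A :=
  [ffun v => sigma (val v)].

Variable mu : config -> R.

Definition gibbs_support : {set config} := [set sigma | 0 < mu sigma].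

Definition marginal (A : {set T}) (tau : pinning A) : R :=
  \sum_(sigma | restr A sigma == tau) mu sigma.

Definition feasible (A : {set T}) : {set pinning A} :=
  [set tau | 0 < marginal tau].

(* The conditional probability mu (E | sigma_A = tau). *)
Definition cond_prob (A : {set T}) (tau : pinning A) (E : pred config) : R :=
  (\sum_(sigma | (restr A sigma == tau) && E sigma) mu sigma) / marginal tau.

Definition marginally_bounded (b : R) : Prop :=
  forall (A : {set T}) (tau : pinning A) (v : T) (s : 'I_q),
    tau \in feasible A -> v \notin A ->
    0 < cond_prob tau [pred sigma : config | sigma v == s] ->
    b <= cond_prob tau [pred sigma : config | sigma v == s].

Definition cond_feasible (A : {set T}) (tau : pinning A) :
    {set pinning (~: A)} :=
  [set xi | 0 < cond_prob tau [pred sigma : config | restr (~: A) sigma == xi]].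

Definition one_flip (A : {set T}) (tau : pinning A) : rel (pinning (~: A)) :=
  fun xi xi' => [&& xi \in cond_feasible tau, xi' \in cond_feasible tau
                  & #|[set v | xi v != xi' v]| == 1%N].

Definition totally_connected : Prop :=
  forall (A : {set T}) (tau : pinning A), tau \in feasible A ->
    {in cond_feasible tau &, forall xi xi', connect (one_flip tau) xi xi'}.

Definition config_le (ord : T -> rel 'I_q) (sigma sigma' : config) : Prop :=
  forall v, ord v (sigma v) (sigma' v).

Definition pinning_le (ord : T -> rel 'I_q) (A : {set T})
    (tau tau' : pinning A) : Prop :=
  forall v, ord (val v) (tau v) (tau' v).

Definition increasing_event (ord : T -> rel 'I_q) (E : pred config) : Prop :=
  forall sigma sigma', config_le ord sigma sigma' -> E sigma -> E sigma'.

Definition monotone_dist : Prop :=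
  exists ord : T -> rel 'I_q,
    (forall v, [/\ total (ord v), antisymmetric (ord v)
                 & transitive (ord v)]) /\
    forall (A : {set T}) (tau1 tau2 : pinning (~: A)),
      tau1 \in feasible (~: A) -> tau2 \in feasible (~: A) ->
      pinning_le ord tau2 tau1 ->
      forall E, increasing_event ord E -> cond_prob tau2 E <= cond_prob tau1 E.

(* Transition matrices on the support; the state with index i is
   [enum_val i : config]. *)
Definition transition := 'M[R]_#|gibbs_support|.

Definition heat_bath (v : T) : transition :=
  \matrix_(i, j) cond_prob (restr (~: [set v]) (enum_val i))
                           (pred1 (enum_val j : config)).

Definition systematic_scan (phi : seq T) : transition :=
  (\prod_(v <- phi) heat_bath v) * (\prod_(v <- rev phi) heat_bath v).

Definition max_tv_to_gibbs (Q : transition) : R :=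
  \big[Num.max/0]_i tv_dist (Q i) (fun j => mu (enum_val j)).

(* Equal to +oo when the chain never gets 1/4-close to [mu]. *)
Definition mixing_time (P : transition) : \bar R :=
  ereal_inf [set (t%:R)%:E | t in
    [set t : nat | (0 < t)%N /\ max_tv_to_gibbs (P ^+ t) <= 4^-1]].

End FiniteVolume.

Section Lattice.
Variable d : nat.

Definition site := 'rV[int]_d.

Definition next_site (u v : site) : bool :=
  [exists i : 'I_d, v == u + delta_mx 0 i].

Definition adj (u v : site) : bool := next_site u v || next_site v u.

Definition boundary (L : {fset site}) : pred site :=
  fun v => (v \notin L) && [exists u : L, adj (val u) v].

(* The box with lowest corner [a] containing [s i] sites in direction [i]. *)
Definition is_rectangle (a : site) (s : 'I_d -> nat) (L : {fset site}) : Prop :=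
  forall u : site,
    (u \in L) = [forall i, (a 0 i <= u 0 i) && (u 0 i < a 0 i + (s i)%:Z)].

Definition is_cube (L : {fset site}) : Prop :=
  exists (a : site) (m : nat), is_rectangle a (fun=> m) L.

(* Graph distance from [u] to [B]: the least length of a lattice path. *)
Definition dist_to (R : realType) (u : site) (B : {fset site}) : R :=
  inf [set ((size p)%:R : R) | p in
    [set p : seq site | path adj u p && (last u p \in B)]].

End Lattice.

Record spin_system (R : realType) (q : nat) := SpinSystem {
  edge_pot : 'I_q -> 'I_q -> \bar R;
  spin_pot : 'I_q -> R;
  edge_pot_sym : forall s t, edge_pot s t = edge_pot t s;
  edge_pot_nooy : forall s t, edge_pot s t != +oo%E
}.

Section Gibbs.
Variables (R : realType) (d q : nat) (S : spin_system R q).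
Variables (L : {fset site d}) (tau : {fmap site d -> 'I_q}).

(* The first sum visits every edge inside [L] exactly once, oriented in the
   positive direction; no term is +oo, so the sums in [\bar R] are the usual
   sums in R U {-oo}. *)
Definition hamiltonian (sigma : {ffun L -> 'I_q}) : \bar R :=
  (- (\sum_(u : L) \sum_(v : L | next_site (val u) (val v))
        edge_pot S (sigma u) (sigma v))
   - (\sum_(u : L) \sum_(v : domf tau | adj (val u) (val v))
        edge_pot S (sigma u) (tau v))
   - (\sum_(v : L) (spin_pot S (sigma v))%:E))%E.

Definition weight (sigma : {ffun L -> 'I_q}) : R :=
  fine (expeR (- hamiltonian sigma)%E).

Definition partition_function : R := \sum_sigma weight sigma.

Definition gibbs (sigma : {ffun L -> 'I_q}) : R :=
  weight sigma / partition_function.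

(* [domf tau] may be any part of the boundary, including the empty one. *)
Definition boundary_condition : Prop :=
  {subset domf tau <= boundary L} /\ 0 < partition_function.

End Gibbs.

Definition differ_only_at (d q : nat) (tau tau' : {fmap site d -> 'I_q})
    (u : site d) : Prop :=
  [/\ domf tau = domf tau', u \in domf tau
    & forall v, v != u -> tau.[? v]%fmap = tau'.[? v]%fmap].

(* The decay holds with the same alpha and gamma for the rectangles of every
   scale l >= L.  At a single scale it would be void, since distances are then
   bounded and gamma could absorb the exponential. *)
Definition strong_spatial_mixing (R : realType) (d q : nat)
    (S : spin_system R q) : Prop :=
  exists (alpha gamma : R) (L : nat), [/\ 0 < alpha, 0 < gamma, (0 < L)%N &
    forall (l : nat) (a : site d) (s : 'I_d -> nat) (Lam B : {fset site d}),
      (L <= l)%N -> (forall i, (l <= s i <= 2 * l)%N) ->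
      is_rectangle a s Lam -> (B `<=` Lam)%fset ->
    forall (tau tau' : {fmap site d -> 'I_q}) (u : site d),
      boundary_condition S Lam tau -> boundary_condition S Lam tau' ->
      differ_only_at tau tau' u ->
      let BL := [set v : Lam | val v \in B]%SET in
      tv_dist (marginal (gibbs S tau) (A := BL))
              (marginal (gibbs S tau') (A := BL))
        <= gamma * expR (- alpha * dist_to R u B)].

(* Main.v *)
Require Import Defs.
From HB Require Import structures.
From mathcomp Require Import all_boot all_order all_algebra.
From mathcomp Require Import finmap.
From mathcomp Require Import all_classical all_reals all_analysis.
From mathcomp Require Import zify ring lra.

Set Implicit Arguments.
Unset Strict Implicit.
Unset Printing Implicit Defensive.

Import Order.TTheory GRing.Theory Num.Theory.

Local Open Scope ring_scope.

(** The scan started from the greatest configuration and the scan started from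
    the least one are compared, near each site [v], with runs confined to a box
    around [v] whose size does not depend on [n].

    Heat-bath updates act on functions: [word_op w] is the product of the
    single-site conditional expectations along the word [w].  In a monotone
    system each of them preserves increasing functions ([site_op_incr]), is
    self-adjoint for [mu] ([cexp_adjoint]), and satisfies
    <g, P_u f> <= <g, f> for increasing [f] and [g], which is Chebyshev's
    inequality along the single spin that moves ([site_op_chebyshev]).  These
    three facts give the censoring inequality of Peres and Winkler
    ([censoring]): skipping updates only raises the chain that starts at the
    greatest configuration and only lowers the one that starts at the least.
    The two configurations exist because lowering spins one at a time to their
    least feasible value ends at a configuration which, by total connectedness,
    lies below all others ([fixed_least]).

    Let x_t(v) be the difference between the two chains after [t] scans of the
    expected rank of the spin at [v] ([gap]).  To bound it, censor every update
    outside a box of radius [l] around [v].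

    - With probability bounded below, by marginal boundedness, a bounded number
      of scans of the box drives it to the least configuration that its outside
      allows, whatever the start.  By Doeblin's argument a bounded number of
      scans then brings the expectation of a function to within eps of its
      conditional expectation given the outside ([word_op_near_cexp]).
    - By the spatial Markov property this conditional law is the Gibbs law of
      the box with an induced boundary condition ([cexp_gibbs]), so that strong
      spatial mixing bounds the effect at [v] of one boundary spin by a
      multiple of exp(- alpha l) ([box_decay]).
    - The function of the starting configuration obtained in this way depends
      only on a window of (2 l + 3)^d sites ([word_op_local]).

    Hence x_{t+T}(v) <= kappa * sum of x_t(u) over the window of [v], with
    kappa of order eps + exp(- alpha l) ([influence], [gap_step]).  Choose first
    [l] and then the number [T] of scans so that kappa (2 l + 3)^d <= 1/2.  Then
    every x(v) is halved by [T] scans ([gap_iter]).  The total variation distance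
    to [mu] is at most twice the sum of the x(v) ([word_op_tv]), and a number of
    scans of order log n suffices.

    Strong spatial mixing compares boundary conditions that differ at one
    vertex and are both feasible, so two comparable configurations have to be
    joined by single flips inside the support.  Both lie above the least
    configuration that agrees with them off the set where they differ.  The
    larger one is made to descend to it rather than to the smaller one; each
    spin then changes by at most [q] ranks ([descent]), which loses only a
    factor [q]. *)

(** * Level sets and conditional expectations *)

(** The layer-cake formula: [f] is a constant plus a nonnegative combination of
    the indicators of its upper level sets.  The induction lowers the largest
    value of [f] to the second largest. *)
Lemma sum_ge0_of_levels (R : realType) (X : finType) (p f : X -> R) :
  \sum_x p x = 0 -> (forall t : R, 0 <= \sum_x p x * (t <= f x)%R%:R) ->
  0 <= \sum_x p x * f x.
Proof.
move=> p0; move: {2}(#|_|) (leqnn #|[set x | [exists y, f x < f y]]|) => n.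
elim: n f => [|n IHn] f cardf lev_ge0.
all: case: (pickP X) => [x _|X0]; last by rewrite big_pred0.
all: have [x0 _ x0max'] := @arg_maxP _ _ X x predT f isT.
all: have x0max y : f y <= f x0 by exact: x0max'.
- have fE y : f y = f x0.
    apply/eqP; rewrite eq_le x0max /= leNgt; apply/negP => lt_y.
    move: cardf; rewrite leqn0 cards_eq0 => /eqP/setP/(_ y).
    by rewrite !inE => /negbT/negP; apply; apply/existsP; exists x0.
  under eq_bigr do rewrite fE.
  by rewrite -big_distrl /= p0 mul0r.
have [[x1 x1P]|noB] := boolp.pselect (exists y, f y < f x0); last first.
  have fE y : f y = f x0.
    apply/eqP; rewrite eq_le x0max /= leNgt; apply/negP => lt_y.
    by apply: noB; exists y.
  under eq_bigr do rewrite fE.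
  by rewrite -big_distrl /= p0 mul0r.
have [y1 y1P y1max'] := @arg_maxP _ _ X x1 (fun y => f y < f x0) f x1P.
have y1max y : f y < f x0 -> f y <= f y1 by exact: y1max'.
pose f' x := Num.min (f x) (f y1).
have fE y : f y = f' y + (f x0 - f y1) * (f x0 <= f y)%R%:R.
  have [le|lt] := leP (f x0) (f y).
    have fyE : f y = f x0 by apply/eqP; rewrite eq_le le x0max.
    by rewrite /f' fyE min_r ?(ltW y1P) //= mulr1 addrC subrK.
  by rewrite /= mulr0 addr0 /f' min_l // y1max.
under eq_bigr do rewrite fE mulrDr mulrCA.
rewrite big_split /= -mulr_sumr addr_ge0 //; last first.
  by rewrite mulr_ge0 ?lev_ge0 // subr_ge0 ltW.
apply: IHn.
  rewrite -ltnS; apply: leq_trans cardf; apply: proper_card.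
  apply/properP; split.
    apply/fintype.subsetP => z; rewrite !inE => /existsP[y].
    rewrite /f' lt_min => /andP[].
    rewrite !gt_min ltxx orbF => _ lt_z; apply/existsP; exists y1.
    exact: lt_z.
  exists y1; rewrite !inE; first by apply/existsP; exists x0.
  apply/negP => /existsP[y]; rewrite /f' minxx lt_min ltxx andbF //.
move=> t; have [le|lt] := leP t (f y1).
  rewrite (_ : \sum__ _ = \sum_x p x * (t <= f x)%R%:R) //.
  by apply: eq_bigr => y _; rewrite /f' le_min le andbT.
rewrite big1 // => y _; rewrite /f' le_min leNgt.
by rewrite [t <= f y1]leNgt lt andbF mulr0.
Qed.

Section SpinChain.
Variables (R : realType) (T : finType) (q : nat).
Notation config := {ffun T -> 'I_q}.
Variable mu : config -> R.
Hypothesis mu_ge0 : forall x, 0 <= mu x.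
Implicit Types (A B : {set T}) (x y z : config) (f g : config -> R) (w : seq T).

Definition agree (A : {set T}) (x y : config) : bool :=
  [forall v, (v \notin A) ==> (x v == y v)].

Lemma agreeP A x y : reflect (forall v, v \notin A -> x v = y v) (agree A x y).
Proof.
apply: (iffP forallP) => [h v vA|h v]; first by move/implyP/(_ vA)/eqP: (h v).
by apply/implyP => vA; apply/eqP/h.
Qed.

Lemma agree_refl A x : agree A x x.
Proof. by apply/agreeP. Qed.

Lemma agree_sym A x y : agree A x y = agree A y x.
Proof. by apply/agreeP/agreeP => h v /h. Qed.

Lemma agree_trans A : transitive (agree A).
Proof. by move=> y x z /agreeP h /agreeP h'; apply/agreeP => v vA; rewrite h ?h'. Qed.

Lemma agree_left A x y z : agree A x y -> agree A x z = agree A y z.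
Proof.
move=> xy; apply/idP/idP => [|/(agree_trans xy)] //.
by rewrite agree_sym in xy; exact: agree_trans.
Qed.

Lemma agreeS (A B : {set T}) x y : A \subset B -> agree A x y -> agree B x y.
Proof.
move=> /fintype.subsetP AB /agreeP h; apply/agreeP => v vB; apply: h.
by apply: contra vB; exact: AB.
Qed.

Lemma restr_agree A x y : (restr (~: A) x == restr (~: A) y) = agree A x y.
Proof.
apply/eqP/agreeP => [/ffunP h v vA|h]; last first.
  by apply/ffunP => -[v vA]; rewrite !ffunE /= h // -finset.in_setC.
rewrite -finset.in_setC in vA; by move: (h (exist _ v vA)); rewrite !ffunE.
Qed.

Definition fibre_mass A x : R := \sum_(y | agree A x y) mu y.

Definition kern A x y : R := if agree A x y then mu y / fibre_mass A x else 0.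

Definition cexp A (f : config -> R) x : R := \sum_y kern A x y * f y.

Lemma fibre_mass_gt0 A x : 0 < mu x -> 0 < fibre_mass A x.
Proof.
move=> x0; rewrite /fibre_mass (bigD1 x) ?agree_refl //=.
by rewrite ltr_pwDl // sumr_ge0.
Qed.

Lemma fibre_mass_agree A x y : agree A x y -> fibre_mass A x = fibre_mass A y.
Proof. by move=> xy; apply: eq_bigl => z; apply: agree_left. Qed.

Lemma fibre_mass_ge0 A x : 0 <= fibre_mass A x.
Proof. exact: sumr_ge0. Qed.

Lemma kern_ge0 A x y : 0 <= kern A x y.
Proof. by rewrite /kern; case: ifP => // _; rewrite divr_ge0 // fibre_mass_ge0. Qed.

Lemma kern_sum A x : 0 < mu x -> \sum_y kern A x y = 1.
Proof.
move=> x0; rewrite /kern -big_mkcond -mulr_suml divff //.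
by rewrite gt_eqF // fibre_mass_gt0.
Qed.

Lemma kern0 A x y : ~~ (0 < mu y) -> kern A x y = 0.
Proof.
rewrite lt_neqAle mu_ge0 andbT negbK => /eqP y0.
by rewrite /kern -y0 mul0r if_same.
Qed.

Lemma kern_neq0 A x y : kern A x y != 0 -> 0 < mu y /\ agree A x y.
Proof.
move=> h; split; first by apply: contraR h => /kern0 ->.
by move: h; rewrite /kern; case: ifP => //; rewrite eqxx.
Qed.

Lemma kern_self_gt0 A x y : agree A x y -> 0 < mu x -> 0 < mu y -> 0 < kern A x y.
Proof. by move=> xy x0 y0; rewrite /kern xy divr_gt0 // fibre_mass_gt0. Qed.

Lemma kern_agree A x y z : agree A x y -> kern A x z = kern A y z.
Proof. by move=> xy; rewrite /kern (agree_left _ xy) (fibre_mass_agree xy). Qed.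

Lemma kern_rev A x y : mu x * kern A x y = mu y * kern A y x.
Proof.
rewrite /kern agree_sym; case: ifP => [yx|]; last by rewrite !mulr0.
by rewrite (fibre_mass_agree yx) mulrCA.
Qed.

Lemma cexp_agree A f x y : agree A x y -> cexp A f x = cexp A f y.
Proof. by move=> xy; apply: eq_bigr => z _; rewrite (kern_agree _ xy). Qed.

Lemma eq_cexp A f g x : (forall y, 0 < mu y -> agree A x y -> f y = g y) ->
  cexp A f x = cexp A g x.
Proof.
move=> fg; apply: eq_bigr => y _; have [->|/kern_neq0[]] := eqVneq (kern A x y) 0.
  by rewrite !mul0r.
by move=> y0 xy; rewrite fg.
Qed.

Lemma le_cexp A f g x : (forall y, 0 < mu y -> agree A x y -> f y <= g y) ->
  cexp A f x <= cexp A g x.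
Proof.
move=> fg; apply: ler_sum => y _; have [->|/kern_neq0[]] := eqVneq (kern A x y) 0.
  by rewrite !mul0r.
by move=> y0 xy; rewrite ler_wpM2l ?kern_ge0 // fg.
Qed.

Lemma cexpD A f g x : cexp A (fun y => f y + g y) x = cexp A f x + cexp A g x.
Proof. by rewrite /cexp -big_split; apply: eq_bigr => y _; rewrite mulrDr. Qed.

Lemma cexpZ A c f x : cexp A (fun y => c * f y) x = c * cexp A f x.
Proof. by rewrite /cexp mulr_sumr; apply: eq_bigr => y _; rewrite mulrCA. Qed.

Lemma cexp_cst A c x : 0 < mu x -> cexp A (fun=> c) x = c.
Proof. by move=> x0; rewrite /cexp -mulr_suml kern_sum // mul1r. Qed.

Lemma cexp_ge0 A f x : (forall y, 0 < mu y -> agree A x y -> 0 <= f y) ->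
  0 <= cexp A f x.
Proof.
move=> f0; rewrite (_ : 0 = cexp A (fun=> 0) x); first exact: le_cexp.
by rewrite /cexp big1 // => y _; rewrite mulr0.
Qed.

Lemma cond_probE A x (E : pred config) :
  cond_prob mu (restr (~: A) x) E = cexp A (fun y => (E y)%:R) x.
Proof.
rewrite /cond_prob /cexp /marginal.
under eq_bigl do rewrite restr_agree agree_sym.
under [X in _ / X]eq_bigl do rewrite restr_agree agree_sym.
rewrite mulr_suml big_mkcond /=; apply: eq_bigr => y _.
by rewrite /kern; case: (agree A x y); case: (E y); rewrite /= ?mulr0 ?mulr1 ?mul0r.
Qed.

Lemma feasible_restr A x : 0 < mu x -> restr A x \in feasible mu A.
Proof.
move=> x0; rewrite inE /marginal (bigD1 x) ?eqxx //=.
by rewrite ltr_pwDl // sumr_ge0.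
Qed.

Definition dotp (g f : config -> R) : R := \sum_x mu x * g x * f x.

Lemma cexp_adjoint A g f : dotp g (cexp A f) = dotp (cexp A g) f.
Proof.
rewrite /dotp /cexp.
transitivity (\sum_x \sum_y mu x * kern A x y * (g x * f y)).
  by apply: eq_bigr => x _; rewrite mulr_sumr; apply: eq_bigr => y _; ring.
rewrite exchange_big; apply: eq_bigr => x _ /=.
rewrite mulrAC mulr_sumr; apply: eq_bigr => y _.
by rewrite kern_rev; ring.
Qed.

Lemma eq_dotpl g1 g2 f : (forall x, 0 < mu x -> g1 x = g2 x) -> dotp g1 f = dotp g2 f.
Proof.
move=> h; apply: eq_bigr => x _; have [/h ->//|] := boolP (0 < mu x).
rewrite lt_neqAle mu_ge0 andbT negbK => /eqP <-.
by rewrite !mul0r.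
Qed.

(** By self-adjointness, [cexp B] may be moved onto the indicator of the fibre
    of [x], which it leaves unchanged. *)
Lemma cexp_tower (A B : {set T}) f x : B \subset A -> 0 < mu x ->
  cexp A (cexp B f) x = cexp A f x.
Proof.
move=> BA x0; pose g y : R := (agree A x y)%:R / fibre_mass A x.
have cE h : cexp A h x = dotp g h.
  apply: eq_bigr => y _; rewrite /kern /g.
  by case: ifP => _; rewrite ?mul1r ?mul0r ?mulr0 ?mul0r.
rewrite !cE cexp_adjoint; apply: eq_dotpl => y y0.
rewrite (@eq_cexp _ _ (fun=> g y)) ?cexp_cst // => z z0 yz.
rewrite /g; congr (_%:R / _); congr nat_of_bool.
by rewrite ![agree A x _]agree_sym (agree_left _ (agreeS BA yz)).
Qed.

(** * Words of single-site updates *)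

Definition site_op u := cexp [set u].

Definition word_op (w : seq T) (f : config -> R) : config -> R :=
  foldr site_op f w.

Lemma word_op_cat w1 w2 f : word_op (w1 ++ w2) f = word_op w1 (word_op w2 f).
Proof. by rewrite /word_op foldr_cat. Qed.

Lemma eq_word_op w f g x : 0 < mu x -> (forall y, 0 < mu y -> f y = g y) ->
  word_op w f x = word_op w g x.
Proof.
move=> + fg; elim: w x => [|u w IHw] x x0 /=; first exact: fg.
by apply: eq_cexp => y y0 _; exact: IHw.
Qed.

Lemma word_opD w f g x : word_op w (fun y => f y + g y) x = word_op w f x + word_op w g x.
Proof.
elim: w x => [//|u w IHw] x /=; rewrite -cexpD.
by apply: eq_bigr => y _; rewrite IHw.
Qed.

Lemma word_opZ w c f x : word_op w (fun y => c * f y) x = c * word_op w f x.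
Proof.
elim: w x => [//|u w IHw] x /=; rewrite -cexpZ.
by apply: eq_bigr => y _; rewrite IHw.
Qed.

Lemma word_op_sum (I : Type) (r : seq I) (Q : pred I) (F : I -> config -> R) w x :
  word_op w (fun y => \sum_(i <- r | Q i) F i y) x = \sum_(i <- r | Q i) word_op w (F i) x.
Proof.
elim: w x => [//|u w IHw] x /=.
rewrite /site_op /cexp exchange_big /=; apply: eq_bigr => y _; rewrite IHw.
by rewrite mulr_sumr.
Qed.

Lemma word_op_cst w c x : 0 < mu x -> word_op w (fun=> c) x = c.
Proof.
elim: w x => [//|u w IHw] x x0 /=.
by rewrite -[RHS](cexp_cst [set u] c x0); apply: eq_cexp => y y0 _; exact: IHw.
Qed.

Lemma word_op_dotp w g f : dotp g (word_op w f) = dotp (word_op (rev w) g) f.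
Proof.
elim: w g => [//|u w IHw] g /=.
by rewrite cexp_adjoint IHw rev_cons -cats1 word_op_cat.
Qed.

Lemma word_op_cexp (A : {set T}) w f x : {subset w <= A} -> 0 < mu x ->
  cexp A (word_op w f) x = cexp A f x.
Proof.
move=> + x0; elim: w => [//|u w IHw] wA /=.
rewrite cexp_tower ?IHw //; first by move=> v vw; rewrite wA // inE vw orbT.
by rewrite finset.sub1set wA // mem_head.
Qed.

Section Ranked.
Variable rk : T -> 'I_q -> nat.
Hypothesis rk_inj : forall v, injective (rk v).

Definition cle x y : bool := [forall v, (rk v (x v) <= rk v (y v))%N].

Lemma cleP x y : reflect (forall v, (rk v (x v) <= rk v (y v))%N) (cle x y).
Proof. exact: forallP. Qed.

Lemma cle_refl x : cle x x.
Proof. exact/cleP. Qed.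

Lemma cle_trans y x z : cle x y -> cle y z -> cle x z.
Proof. by move=> /cleP h /cleP h'; apply/cleP => v; apply: leq_trans (h' v). Qed.

Lemma cle_anti x y : cle x y -> cle y x -> x = y.
Proof.
move=> /cleP h /cleP h'; apply/ffunP => v; apply: (@rk_inj v).
by apply/eqP; rewrite eqn_leq h h'.
Qed.

Lemma cle_total_at u x y : agree [set u] x y -> cle x y || cle y x.
Proof.
move=> /agreeP xy; have [le|/ltnW le] := leqP (rk u (x u)) (rk u (y u)).
  apply/orP; left; apply/cleP => v; have [->//|vu] := eqVneq v u.
  by rewrite xy // inE.
apply/orP; right; apply/cleP => v; have [->//|vu] := eqVneq v u.
by rewrite xy // inE.
Qed.

Definition incr f := forall x y, 0 < mu x -> 0 < mu y -> cle x y -> f x <= f y.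

Definition site_monotone := forall u x y, 0 < mu x -> 0 < mu y -> cle x y ->
  forall E : pred config, (forall s t, cle s t -> E s -> E t) ->
  site_op u (fun z => (E z)%:R) x <= site_op u (fun z => (E z)%:R) y.

Hypothesis mono : site_monotone.

(** The monotonicity assumption speaks of events, and level sets extend it to
    functions.  Since [f] is only known to increase on the support, the level
    set is replaced by its up-closure, which has the same trace there. *)
Lemma site_op_incr u f : incr f -> incr (site_op u f).
Proof.
move=> fi x y x0 y0 xy; rewrite -subr_ge0 /site_op /cexp -sumrB.
under eq_bigr do rewrite -mulrBl.
apply: sum_ge0_of_levels => [|t]; first by rewrite sumrB !kern_sum // subrr.
pose E z := [exists s, [&& 0 < mu s, t <= f s & cle s z]].
have fE z : 0 < mu z -> (t <= f z) = E z.
  move=> z0; apply/idP/existsP => [tz|[s /and3P[s0 ts sz]]].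
    by exists z; rewrite z0 tz cle_refl.
  exact: le_trans (fi _ _ s0 z0 sz).
have Ei s s' : cle s s' -> E s -> E s'.
  move=> ss' /existsP[r /and3P[r0 tr rs]]; apply/existsP; exists r.
  by rewrite r0 tr (cle_trans rs).
under eq_bigr do rewrite mulrBl.
rewrite sumrB subr_ge0.
have := mono u x0 y0 xy Ei.
rewrite -[X in X <= _](@eq_cexp _ (fun z => (t <= f z)%R%:R)); last first.
  by move=> z z0 _; rewrite fE.
rewrite -[X in _ <= X](@eq_cexp _ (fun z => (t <= f z)%R%:R)) //.
by move=> z z0 _; rewrite fE.
Qed.

Lemma word_op_incr w f : incr f -> incr (word_op w f).
Proof. by move=> fi; elim: w => //= u w; exact: site_op_incr. Qed.

(** Symmetrizing in the old and the new configuration turns the difference into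
    a sum of (g x - g y) (f x - f y) with nonnegative weights.  As [x] and [y]
    differ at one vertex they are comparable, so both factors have one sign. *)
Lemma site_op_chebyshev u g f : incr g -> incr f ->
  dotp g (site_op u f) <= dotp g f.
Proof.
move=> gi fi; rewrite -subr_ge0.
pose W x y := mu x * kern [set u] x y.
have WC x y : W x y = W y x by exact: kern_rev.
have E : dotp g f - dotp g (site_op u f) =
    \sum_x \sum_y W x y * (g x * (f x - f y)).
  rewrite /dotp -sumrB; apply: eq_bigr => x _.
  have [x0|/negbTE x0] := boolP (0 < mu x); last first.
    have {}x0 : mu x = 0.
      by apply/eqP; move: x0; rewrite lt_neqAle mu_ge0 andbT => /negbFE; rewrite eq_sym.
    rewrite x0 !mul0r subrr big1 // => y _.
    by rewrite /W x0 !mul0r.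
  transitivity (mu x * g x * (\sum_y kern [set u] x y * (f x - f y))).
    rewrite -mulrBr; congr (_ * _); under [RHS]eq_bigr do rewrite mulrBr.
    by rewrite sumrB -mulr_suml kern_sum // mul1r.
  by rewrite mulr_sumr; apply: eq_bigr => y _; rewrite /W; ring.
have E' : dotp g f - dotp g (site_op u f) =
    \sum_x \sum_y W x y * (g y * (f y - f x)).
  rewrite E exchange_big; apply: eq_bigr => x _; apply: eq_bigr => y _ /=.
  by rewrite WC.
rewrite -(@pmulr_rge0 _ 2) // mulr2n mulrDl mul1r {1}E E' -big_split /=.
apply: sumr_ge0 => x _; rewrite -big_split; apply: sumr_ge0 => y _ /=.
rewrite -mulrDr (_ : _ + _ = (g x - g y) * (f x - f y)); last by ring.
rewrite /W; have [->|xNy] := eqVneq (kern [set u] x y) 0; first by rewrite mulr0 mul0r.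
have [y0 xy] := kern_neq0 xNy; rewrite -mulrA.
have [x0|/negbTE x0] := boolP (0 < mu x); last first.
  move: x0; rewrite lt_neqAle mu_ge0 andbT => /negbFE/eqP <-.
  by rewrite mul0r.
rewrite mulr_ge0 ?mu_ge0 // mulr_ge0 ?kern_ge0 //.
have /orP[le|le] := cle_total_at xy.
  by rewrite mulr_le0 // subr_le0 ?gi ?fi.
by rewrite mulr_ge0 // subr_ge0 ?gi ?fi.
Qed.

(** The letters of [w] are treated from left to right: a skipped letter is
    removed by Chebyshev's inequality, and a kept one is moved onto [g], which
    stays increasing. *)
Lemma censoring (Q : pred T) w g f : incr g -> incr f ->
  dotp g (word_op w f) <= dotp g (word_op [seq u <- w | Q u] f).
Proof.
move=> gi fi; elim: w g gi => [//|u w IHw] g gi /=.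
case: (Q u) => /=; last first.
  apply: le_trans (IHw _ gi).
  by apply: site_op_chebyshev => //; exact: word_op_incr.
by rewrite !cexp_adjoint; apply: IHw; exact: site_op_incr.
Qed.

Definition greatest x := 0 < mu x /\ forall y, 0 < mu y -> cle y x.
Definition least x := 0 < mu x /\ forall y, 0 < mu y -> cle x y.

(** Evaluation at a greatest configuration is, up to a factor, the scalar
    product with its indicator, and this indicator is increasing. *)
Lemma censoring_greatest (Q : pred T) w0 w f x : greatest x -> incr f ->
  word_op w0 (word_op w f) x <= word_op w0 (word_op [seq u <- w | Q u] f) x.
Proof.
move=> [x0 xmax] fi; pose g y : R := (y == x)%:R.
have gE h : dotp g h = mu x * h x.
  rewrite /dotp (bigD1 x) //= /g eqxx /= mulr1 big1 ?addr0 // => y /negbTE ->.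
  by rewrite mulr0 mul0r.
rewrite -(ler_pM2l x0) -!gE word_op_dotp [leRHS]word_op_dotp.
apply: censoring => //; apply: word_op_incr => y z y0 z0 yz; rewrite /g.
have [yx|_] := eqVneq y x; last by rewrite ler0n.
by rewrite -yx (cle_anti yz) ?yx ?xmax // eqxx.
Qed.

(** Here it is the opposite of the indicator that is increasing. *)
Lemma censoring_least (Q : pred T) w0 w f x : least x -> incr f ->
  word_op w0 (word_op [seq u <- w | Q u] f) x <= word_op w0 (word_op w f) x.
Proof.
move=> [x0 xmin] fi; pose g y : R := - (y == x)%:R.
have gE h : dotp g h = - (mu x * h x).
  rewrite /dotp (bigD1 x) //= /g eqxx /= mulrN1 mulNr big1 ?addr0 // => y /negbTE ->.
  by rewrite mulrN mulr0 oppr0 mul0r.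
rewrite -(ler_pM2l x0) -lerN2 -!gE word_op_dotp [leRHS]word_op_dotp.
apply: censoring => //; apply: word_op_incr => y z y0 z0 yz; rewrite /g lerN2.
have [zx|_] := eqVneq z x; last by rewrite ler0n.
by rewrite -zx (cle_anti yz) ?zx ?xmin // eqxx.
Qed.

(** * Lowering a spin *)

Definition lower u x : config :=
  arg_min x (fun z => (0 < mu z) && agree [set u] x z) (fun z => rk u (z u)).

Lemma lowerP u x : 0 < mu x ->
  [/\ 0 < mu (lower u x), agree [set u] x (lower u x) &
    forall z, 0 < mu z -> agree [set u] x z -> (rk u (lower u x u) <= rk u (z u))%N].
Proof.
move=> x0; rewrite /lower; case: arg_minnP.
  by rewrite x0 agree_refl.
move=> z /andP[z0 xz] zmin.
by split=> // s s0 xs; apply: zmin; rewrite s0.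
Qed.

Lemma lower_cle u x : 0 < mu x -> cle (lower u x) x.
Proof.
move=> x0; have [_ /agreeP xz zmin] := lowerP u x0; apply/cleP => v.
have [->|vu] := eqVneq v u; first by rewrite zmin // agree_refl.
by rewrite xz // inE.
Qed.

(** Otherwise the event that the rank at [u] is at least its minimum given [x]
    would be certain given [x] but not given the larger [y]. *)
Lemma lower_mono u x y : 0 < mu x -> 0 < mu y -> cle x y ->
  (rk u (lower u x u) <= rk u (lower u y u))%N.
Proof.
move=> x0 y0 xy; rewrite leqNgt; apply/negP => lt.
have [a0 xa amin] := lowerP u x0; have [c0 yc cmin] := lowerP u y0.
pose E z := (rk u (lower u x u) <= rk u (z u))%N.
have Ei s t : cle s t -> E s -> E t.
  by move=> /cleP/(_ u) st Es; apply: leq_trans st.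
have := mono u x0 y0 xy Ei.
rewrite /site_op (@eq_cexp _ _ (fun=> 1)) ?cexp_cst //; last first.
  by move=> z z0 xz; rewrite /E amin.
apply/negP; rewrite -ltNge -[ltRHS](kern_sum [set u] y0) /cexp.
rewrite (bigD1 (lower u y)) //= [ltRHS](bigD1 (lower u y)) //=.
rewrite {1}/E leqNgt lt /= mulr0 add0r.
apply: (@le_lt_trans _ _ (\sum_(z | z != lower u y) kern [set u] y z)).
  apply: ler_sum => z _; rewrite ler_piMr ?kern_ge0 //.
  by case: (E z); rewrite /= ?ler01.
by rewrite ltrDr kern_self_gt0.
Qed.

Hypothesis fib_conn : forall (D : {set T}) x y (Q : config -> Prop),
  0 < mu x -> 0 < mu y -> agree D x y -> Q x ->
  (forall s t u, 0 < mu s -> 0 < mu t -> u \in D -> agree [set u] s t ->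
     Q s -> Q t) ->
  Q y.

(** Along a path of single flips from [x] to [y] inside the fibre the
    configuration stays above [x]: the flipped spin is at least the least one
    feasible there, which by monotonicity is at least the one feasible at [x]. *)
Lemma fixed_least (D : {set T}) x y : 0 < mu x ->
  (forall u, u \in D -> lower u x = x) ->
  0 < mu y -> agree D x y -> cle x y.
Proof.
move=> x0 xfix y0 xy; apply: (@fib_conn D x y (cle x)) => //; first exact: cle_refl.
move=> s t u s0 t0 uD st xs; apply/cleP => v; have [->|vu] := eqVneq v u.
  have [_ _ smin] := lowerP u s0.
  by rewrite -{1}(xfix u uD); apply: leq_trans (smin _ t0 st); exact: lower_mono.
by move/agreeP: st => <-; [move/cleP: xs|rewrite inE].
Qed.

Definition rksum (D : {set T}) x := (\sum_(v in D) rk v (x v))%N.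

Lemma cle_rksum D x y : cle x y -> (rksum D x <= rksum D y)%N.
Proof. by move=> /cleP xy; apply: leq_sum => v _; exact: xy. Qed.

Lemma lower_neq u x : 0 < mu x -> lower u x <> x -> (rk u (lower u x u) < rk u (x u))%N.
Proof.
move=> x0 ne; rewrite ltnNge; apply/negP => le; apply: ne; apply: cle_anti.
  exact: lower_cle.
apply/cleP => v; have [->//|vu] := eqVneq v u.
by have [_ /agreeP-> //] := lowerP u x0; rewrite inE.
Qed.

Lemma rksum_lower (D : {set T}) u x : 0 < mu x -> u \in D -> lower u x <> x ->
  (rksum D (lower u x) < rksum D x)%N.
Proof.
move=> x0 uD ne; rewrite /rksum (bigD1 u) //= [ltnRHS](bigD1 u) //=.
rewrite -addSn leq_add ?lower_neq // leq_sum // => v _.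
by have /cleP/(_ v) := lower_cle u x0.
Qed.

(** Walking down from [x] to the least element of its fibre, one spin at a
    time, bounds the variation of a function by its single-site variations. *)
Lemma descent (D : {set T}) (F : config -> R) (c : T -> R) x : 0 < mu x ->
  (forall u, 0 <= c u) ->
  (forall u s t, u \in D -> 0 < mu s -> 0 < mu t -> agree [set u] s t ->
     F s - F t <= c u) ->
  exists z, [/\ 0 < mu z, agree D x z,
    (forall y, 0 < mu y -> agree D x y -> cle z y) &
    F x - F z <= \sum_(u in D) c u * ((rk u (x u))%:R - (rk u (z u))%:R)].
Proof.
move=> x0 c0 Fc.
move: {2}(rksum D x).+1 (ltnSn (rksum D x)) => n.
elim: n x x0 => [//|n IHn] x x0 xn.
have [xfix|] := boolp.pselect (forall u, u \in D -> lower u x = x).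
  exists x; split=> //; first exact: agree_refl.
    by move=> y y0 xy; exact: fixed_least xy.
  by rewrite subrr big1 // => u _; rewrite subrr mulr0.
rewrite -boolp.existsNE => -[u]; rewrite boolp.not_implyE => -[uD ne].
have [s0 xs _] := lowerP u x0.
have xsD : agree D x (lower u x) by apply: agreeS xs; rewrite finset.sub1set.
have [|z [z0 sz zmin zb]] := IHn _ s0.
  by rewrite -ltnS; apply: leq_trans xn; rewrite ltnS rksum_lower.
exists z; split=> //; first exact: agree_trans sz.
  by move=> y y0 xy; apply: zmin => //; rewrite -(agree_left _ xsD).
have -> : F x - F z = (F x - F (lower u x)) + (F (lower u x) - F z) by ring.
apply: le_trans (lerD (Fc u _ _ uD x0 s0 xs) zb) _.
rewrite (bigD1 u) //= [leRHS](bigD1 u) //= addrA lerD //; last first.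
  rewrite le_eqVlt; apply/orP; left; apply/eqP; apply: eq_bigr => v /andP[_ vu].
  by move/agreeP: xs => -> //; rewrite inE.
have lt := lower_neq x0 ne.
have : (rk u (lower u x u))%:R + 1 <= (rk u (x u))%:R :> R.
  by rewrite natr1 ler_nat.
move=> /(ler_wpM2l (c0 u)); rewrite mulrDr mulr1 => h.
by rewrite !mulrBr addrA lerD2r addrC.
Qed.

Lemma exists_least x : 0 < mu x -> exists z, least z.
Proof.
move=> x0; have [|u s t _ _ _ _|z [z0 _ zmin _]] :=
  @descent [set: T]%SET (fun=> 0) (fun=> 0) x x0; rewrite ?subrr //.
exists z; split=> // y y0; apply: zmin => //.
by apply/agreeP => v; rewrite inE.
Qed.

(** * Doeblin minorization inside a block *)

Definition lower_word w x := foldl (fun y u => lower u y) x w.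

Lemma lower_wordP (D : {set T}) w x : {subset w <= D} -> 0 < mu x ->
  [/\ 0 < mu (lower_word w x), agree D x (lower_word w x) &
     (rksum D (lower_word w x) <= rksum D x)%N].
Proof.
elim: w x => [|u w IHw] x wD x0 /=; first by rewrite agree_refl.
have [s0 xs _] := lowerP u x0.
have uD : u \in D by rewrite wD // mem_head.
have [||t0 st le] := IHw (lower u x) => //.
  by move=> v vw; rewrite wD // inE vw orbT.
split=> //.
  by apply: agree_trans st; apply: agreeS xs; rewrite finset.sub1set.
by apply: leq_trans le _; apply: cle_rksum; exact: lower_cle.
Qed.

Lemma lower_word_fixed w x : (forall u, u \in w -> lower u x = x) -> lower_word w x = x.
Proof.
elim: w => [//|u w IHw] h /=; rewrite h ?mem_head // IHw // => v vw.
by rewrite h // inE vw orbT.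
Qed.

Lemma lower_word_lt (D : {set T}) w x : {subset w <= D} -> 0 < mu x ->
  (rksum D (lower_word w x) < rksum D x)%N \/ forall u, u \in w -> lower u x = x.
Proof.
elim: w x => [|u w IHw] x wD x0; first by right.
have uD : u \in D by rewrite wD // mem_head.
have wD' : {subset w <= D} by move=> v vw; rewrite wD // inE vw orbT.
have [s0 _ _] := lowerP u x0.
have [eqx|ne] := eqVneq (lower u x) x; last first.
  left; apply: leq_ltn_trans (rksum_lower x0 uD (elimN eqP ne)).
  by have [] := lower_wordP wD' s0.
have [lt|fix_w] := IHw _ wD' x0; first by left; rewrite /= eqx.
by right => v; rewrite inE => /predU1P[->//|]; exact: fix_w.
Qed.

(** A pass over [w] that is not idle lowers [rksum], so [j] passes end at a
    configuration fixed by every letter. *)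
Lemma lower_word_iter (D : {set T}) w j x : {subset w <= D} -> 0 < mu x ->
  (rksum D x <= j)%N ->
  forall u, u \in w -> lower u (lower_word (flatten (nseq j w)) x) =
                       lower_word (flatten (nseq j w)) x.
Proof.
move=> wD; elim: j x => [|j IHj] x x0 xj /=.
  have [|//] := lower_word_lt wD x0.
  by move/leq_trans/(_ xj).
rewrite /lower_word foldl_cat -/(lower_word w x).
have [lt|fix_w] := lower_word_lt wD x0; last first.
  rewrite (lower_word_fixed fix_w) -/(lower_word _ x) lower_word_fixed // => u.
  by case/flattenP => w' /nseqP[-> _]; exact: fix_w.
have [s0 _ _] := lower_wordP wD x0.
by apply: IHj => //; rewrite -ltnS (leq_trans lt).
Qed.

Variable b : R.
Hypothesis b_ge0 : 0 <= b.
Hypothesis site_bound : forall u x y, 0 < mu x -> 0 < mu y ->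
  agree [set u] x y -> b <= kern [set u] x y.

Lemma word_op_ge0 (D : {set T}) w f x : {subset w <= D} -> 0 < mu x ->
  (forall y, 0 < mu y -> agree D x y -> 0 <= f y) -> 0 <= word_op w f x.
Proof.
elim: w x => [|u w IHw] x wD x0 f0 /=; first by apply: f0; rewrite ?agree_refl.
apply: cexp_ge0 => y y0 xy.
have uD : u \in D by rewrite wD // mem_head.
have xyD : agree D x y by apply: agreeS xy; rewrite finset.sub1set.
apply: IHw => // [v vw|z z0 yz]; first by rewrite wD // inE vw orbT.
by apply: f0 => //; rewrite (agree_left _ xyD).
Qed.

(** The chain follows the lowering moves with probability at least [b] per
    letter. *)
Lemma word_op_lower (D : {set T}) w f x : {subset w <= D} -> 0 < mu x ->
  (forall y, 0 < mu y -> agree D x y -> 0 <= f y) ->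
  b ^+ size w * f (lower_word w x) <= word_op w f x.
Proof.
elim: w x => [|u w IHw] x wD x0 f0 /=; first by rewrite expr0 mul1r.
have uD : u \in D by rewrite wD // mem_head.
have wD' : {subset w <= D} by move=> v vw; rewrite wD // inE vw orbT.
have [s0 xs _] := lowerP u x0.
have uS y : agree [set u] x y -> agree D x y.
  by apply: agreeS; rewrite finset.sub1set.
have f0' y : agree [set u] x y -> forall z, 0 < mu z -> agree D y z -> 0 <= f z.
  by move=> /uS xy z z0 yz; apply: f0 => //; rewrite (agree_left _ xy).
rewrite /site_op /cexp (bigD1 (lower u x)) //= exprS -mulrA.
rewrite ler_wpDr //.
  apply: sumr_ge0 => y _; have [->|/kern_neq0[y0 xy]] := eqVneq (kern [set u] x y) 0.
    by rewrite mul0r.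
  by rewrite mulr_ge0 ?kern_ge0 // (word_op_ge0 wD') //; exact: f0'.
have h0 : 0 <= b ^+ size w * f (lower_word w (lower u x)).
  rewrite mulr_ge0 ?exprn_ge0 //; have [t0 st _] := lower_wordP wD' s0.
  exact: f0' st.
apply: le_trans (ler_wpM2r h0 (site_bound x0 s0 xs)) _.
rewrite ler_wpM2l ?kern_ge0 //; apply: IHw => //; exact: f0'.
Qed.

(** Doeblin's argument: whatever the start in the fibre, a run along [w] ends at
    [z] with probability at least [p], so it shrinks the range of [f] by the
    factor [1 - p]. *)
Lemma word_op_osc (D : {set T}) w x z (p lo hi : R) f : {subset w <= D} ->
  0 < mu x -> (forall y, 0 < mu y -> agree D x y -> lower_word w y = z) ->
  0 <= p -> p <= b ^+ size w ->
  (forall y, 0 < mu y -> agree D x y -> lo <= f y <= hi) ->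
  exists lo' hi', hi' - lo' = (1 - p) * (hi - lo) /\
    forall y, 0 < mu y -> agree D x y -> lo' <= word_op w f y <= hi'.
Proof.
move=> wD x0 wz p0 pb fb.
have [z0 xz _] := lower_wordP wD x0; rewrite (wz _ x0) ?agree_refl // in z0 xz.
have /andP[loz zhi] := fb _ z0 xz.
exists (lo + p * (f z - lo)), (hi - p * (hi - f z)); split; first by ring.
move=> y y0 xy.
have yD s : agree D y s = agree D x s by rewrite (agree_left _ xy).
have l1 : p * (f z - lo) <= word_op w f y - lo.
  have -> : word_op w f y - lo = word_op w (fun s => f s + - lo) y.
    by rewrite word_opD word_op_cst.
  rewrite -(wz y) //; apply: le_trans (word_op_lower wD y0 _).
    by rewrite ler_wpM2r // wz // subr_ge0.
  by move=> s s0; rewrite yD => /(fb _ s0)/andP[]; rewrite subr_ge0.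
have l2 : p * (hi - f z) <= hi - word_op w f y.
  have -> : hi - word_op w f y = word_op w (fun s => hi + (-1) * f s) y.
    by rewrite word_opD word_op_cst // word_opZ mulN1r.
  have -> : hi - f z = hi + (-1) * f z by rewrite mulN1r.
  rewrite -(wz y) //.
  apply: le_trans (word_op_lower (f := fun s => hi + (-1) * f s) wD y0 _).
    by rewrite ler_wpM2r // wz // mulN1r subr_ge0.
  by move=> s s0; rewrite yD mulN1r => /(fb _ s0)/andP[]; rewrite subr_ge0.
by apply/andP; split; lra.
Qed.

Lemma word_op_osc_iter (D : {set T}) w k x z (p lo hi : R) f : {subset w <= D} ->
  0 < mu x -> (forall y, 0 < mu y -> agree D x y -> lower_word w y = z) ->
  0 <= p -> p <= b ^+ size w ->
  (forall y, 0 < mu y -> agree D x y -> lo <= f y <= hi) ->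
  exists lo' hi', hi' - lo' = (1 - p) ^+ k * (hi - lo) /\
    forall y, 0 < mu y -> agree D x y ->
      lo' <= word_op (flatten (nseq k w)) f y <= hi'.
Proof.
move=> wD x0 wz p0 pb fb; elim: k => [|k [lo' [hi' [E h]]]].
  by exists lo, hi; rewrite expr0 mul1r.
have [lo2 [hi2 [E2 h2]]] := word_op_osc wD x0 wz p0 pb h.
exists lo2, hi2; rewrite E2 E exprS mulrA; split=> // y y0 xy.
by rewrite /= word_op_cat h2.
Qed.

(** A group of [j] passes over the block reaches the least configuration of the
    fibre of [x] with probability at least [p].  The conditional expectation is
    invariant under updates in [D], so it lies in the shrunken range left by [k]
    such groups. *)
Lemma word_op_near_cexp (D : {set T}) w j k x (p lo hi : R) f :
  {subset w <= D} -> {subset D <= w} -> 0 < mu x ->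
  (forall y, (rksum D y <= j)%N) ->
  0 <= p -> p <= b ^+ size (flatten (nseq j w)) ->
  (forall y, lo <= f y <= hi) ->
  `|word_op (flatten (nseq k (flatten (nseq j w)))) f x - cexp D f x|
    <= (1 - p) ^+ k * (hi - lo).
Proof.
move=> wD Dw x0 jD p0 pb fb; set w' := flatten (nseq j w).
have wD' : {subset w' <= D} by move=> v /flattenP[w1 /nseqP[-> _]]; exact: wD.
have low y : 0 < mu y -> forall s, 0 < mu s -> agree D y s -> cle (lower_word w' y) s.
  move=> y0 s s0 ys; have [t0 yt _] := lower_wordP wD' y0.
  apply: (@fixed_least D) => // [u uD|]; last by rewrite -(agree_left _ yt).
  by apply: lower_word_iter wD y0 (jD y) u (Dw u uD).
have wz y : 0 < mu y -> agree D x y -> lower_word w' y = lower_word w' x.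
  move=> y0 xy; have [t0 yt _] := lower_wordP wD' y0.
  have [s0 xs _] := lower_wordP wD' x0.
  apply: cle_anti; apply: low => //; first by rewrite -(agree_left _ xy).
  by rewrite (agree_left _ xy).
have fb' y : 0 < mu y -> agree D x y -> lo <= f y <= hi by [].
have [lo' [hi' [<- h]]] := word_op_osc_iter k wD' x0 wz p0 pb fb'.
rewrite -(@word_op_cexp D (flatten (nseq k w'))) //; last first.
  by move=> v /flattenP[w1 /nseqP[-> _]]; exact: wD'.
have /andP[l1 l2] := h x x0 (agree_refl D x).
set F := word_op _ _ in h l1 l2 *.
have c1 : lo' <= cexp D F x.
  rewrite -[leLHS](cexp_cst D lo' x0); apply: le_cexp => y y0 xy.
  by case/andP: (h y y0 xy).
have c2 : cexp D F x <= hi'.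
  rewrite -[leRHS](cexp_cst D hi' x0); apply: le_cexp => y y0 xy.
  by case/andP: (h y y0 xy).
by rewrite ler_norml; apply/andP; split; lra.
Qed.

(** * Locality *)

Definition local (S : {set T}) f :=
  forall x y, 0 < mu x -> 0 < mu y -> agree (~: S) x y -> f x = f y.

Definition law_local (S : {set T}) u :=
  forall s, local S (cexp [set u] (fun z => (z u == s)%:R)).

Definition set_spin x u s : config := [ffun v => if v == u then s else x v].

Lemma site_opE u f x :
  site_op u f x = \sum_s kern [set u] x (set_spin x u s) * f (set_spin x u s).
Proof.
rewrite /site_op /cexp (partition_big (fun z : config => z u) predT) //=.
apply: eq_bigr => s _; rewrite (bigD1 (set_spin x u s)) /=; last first.
  by rewrite ffunE eqxx.
rewrite big1 ?addr0 // => z /andP[/eqP zs ne].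
have [->|/kern_neq0[_ /agreeP xz]] := eqVneq (kern [set u] x z) 0.
  by rewrite mul0r.
case/eqP: ne; apply/ffunP => v; rewrite ffunE; case: eqVneq => [->//|vu].
by rewrite -xz // inE.
Qed.

Lemma site_lawE u s x :
  cexp [set u] (fun z => (z u == s)%:R) x = kern [set u] x (set_spin x u s).
Proof.
rewrite -/(site_op u _ x) site_opE (bigD1 s) //= ffunE eqxx eqxx mulr1.
rewrite big1 ?addr0 // => t /negbTE ts.
by rewrite ffunE eqxx ts mulr0.
Qed.

(** The law of the new spin and, for each value of it, the updated function
    depend only on the spins in [S]. *)
Lemma site_op_local (S : {set T}) u f : u \in S -> law_local S u -> local S f ->
  local S (site_op u f).
Proof.
move=> uS law loc x y x0 y0 xy; rewrite !site_opE; apply: eq_bigr => s _.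
have := law s x y x0 y0 xy; rewrite !site_lawE => E; rewrite E.
have [->|ne] := eqVneq (kern [set u] y (set_spin y u s)) 0; first by rewrite !mul0r.
have [s0 _] := kern_neq0 ne; rewrite -E in ne; have [t0 _] := kern_neq0 ne.
congr (_ * _); apply: loc => //; apply/agreeP => v.
rewrite inE negbK => vS; rewrite !ffunE; case: eqVneq => // _.
by move/agreeP: xy; apply; rewrite inE negbK.
Qed.

Lemma word_op_local (S : {set T}) w f :
  (forall u, u \in w -> u \in S /\ law_local S u) -> local S f -> local S (word_op w f).
Proof.
move=> + loc; elim: w => [//|u w IHw] h /=.
have [uS lu] := h u (mem_head _ _).
by apply: site_op_local => //; apply: IHw => v vw; apply: h; rewrite inE vw orbT.
Qed.

(** * Influence of a block *)

Definition rkf v x : R := (rk v (x v))%:R.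

Lemma rkf_incr v : incr (rkf v).
Proof. by move=> x y _ _ /cleP xy; rewrite ler_nat. Qed.

Hypothesis rk_lt : forall v s, (rk v s < q)%N.

(** Locality and the two error bounds control a single flip, and [descent] is
    applied to the set where [x] and [y] differ.  The factor [q] appears because
    the descent from [x] may go below [y], by at most [q] ranks at a site where
    [x] and [y] differ by at least one. *)
Lemma influence (D S : {set T}) w (eps delta : R) v x y :
  {subset w <= D} -> D \subset S -> v \in S ->
  (forall u, u \in D -> law_local S u) ->
  (forall x, 0 < mu x -> `|word_op w (rkf v) x - cexp D (rkf v) x| <= eps) ->
  0 <= delta ->
  (forall s t u, 0 < mu s -> 0 < mu t -> u \notin D -> agree [set u] s t ->
    cexp D (rkf v) s - cexp D (rkf v) t <= delta) ->
  0 < mu x -> 0 < mu y -> cle y x ->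
  word_op w (rkf v) x - word_op w (rkf v) y <=
    \sum_(u in S) (2 * eps + delta) * q%:R * (rkf u x - rkf u y).
Proof.
move=> wD DS vS law near delta0 decay x0 y0 yx.
set eta := 2 * eps + delta; set F := word_op w (rkf v).
have eps0 : 0 <= eps by apply: le_trans (normr_ge0 _) (near x x0).
have eta0 : 0 <= eta by rewrite addr_ge0 // mulr_ge0.
have Floc : local S F.
  apply: word_op_local => [u uw|s t s0 t0 st].
    by split; [rewrite (fintype.subsetP DS) ?wD|apply: law; exact: wD].
  by rewrite /rkf; move/agreeP: st => -> //; rewrite inE negbK.
pose A := [set u | x u != y u]; pose c u : R := if u \in S then eta else 0.
have c0 u : 0 <= c u by rewrite /c; case: ifP.
have flip u s t : u \in A -> 0 < mu s -> 0 < mu t -> agree [set u] s t ->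
    F s - F t <= c u.
  move=> _ s0 t0 st; rewrite /c; case: ifPn => uS; last first.
    rewrite (Floc s t) ?subrr //; apply: agreeS st.
    by rewrite finset.sub1set inE.
  have : cexp D (rkf v) s - cexp D (rkf v) t <= delta.
    have [uD|uD] := boolP (u \in D); last exact: decay st.
    rewrite (cexp_agree _ (agreeS _ st)) ?subrr //.
    by rewrite finset.sub1set.
  move: (near s s0) (near t t0); rewrite -/F !ler_norml => /andP[? ?] /andP[? ?].
  by rewrite /eta; lra.
have [z [z0 xz zmin zb]] := descent x0 c0 flip.
have zy : cle z y.
  by apply: zmin => //; apply/agreeP => u; rewrite inE negbK => /eqP.
have Fi : incr F by apply: word_op_incr; exact: rkf_incr.
have le1 : F x - F y <= F x - F z by rewrite lerD2l lerN2 Fi.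
apply: le_trans le1 (le_trans zb _).
rewrite big_mkcond [leRHS]big_mkcond /=; apply: ler_sum => u _.
rewrite inE /c; case: ifPn => [xyu|/negPn/eqP xyu]; case: ifP => uS.
- have lt : (rk u (y u) < rk u (x u))%N.
    rewrite ltn_neqAle; move/cleP: yx => -> /=; rewrite andbT.
    by apply: contra xyu => /eqP/rk_inj ->.
  rewrite -mulrA ler_wpM2l //; apply: (@le_trans _ _ q%:R).
    by rewrite lerBlDr -natrD ler_nat ltnW // ltn_addr.
  rewrite ler_peMr ?ler0n // /rkf lerBrDr addrC natr1 ler_nat //.
- by rewrite mul0r.
- by rewrite /rkf xyu subrr mulr0.
- by [].
Qed.

(** * Contraction of the gap between the extremal chains *)

Variables top bot : config.
Hypothesis topP : greatest top.
Hypothesis botP : least bot.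

Definition gap w v : R := word_op w (rkf v) top - word_op w (rkf v) bot.

(** The assumption says that the weighted sum of the ranks over [S] minus the
    censored expectation is an increasing function, so [word_op w0] preserves
    this order between the two extremal starting points. *)
Lemma gap_step (Q : pred T) (S : {set T}) w0 w v (kappa B : R) (M : nat) :
  0 <= kappa -> 0 <= B -> (#|S| <= M)%N ->
  (forall x y, 0 < mu x -> 0 < mu y -> cle y x ->
   word_op [seq u <- w | Q u] (rkf v) x - word_op [seq u <- w | Q u] (rkf v) y <=
     \sum_(u in S) kappa * (rkf u x - rkf u y)) ->
  (forall u, gap w0 u <= B) ->
  gap (w0 ++ w) v <= kappa * M%:R * B.
Proof.
move=> k0 B0 SM infl gapB; have [top0 topmax] := topP; have [bot0 botmin] := botP.
rewrite /gap !word_op_cat.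
set K := word_op [seq u <- w | Q u] (rkf v) in infl.
have h1 : word_op w0 (word_op w (rkf v)) top <= word_op w0 K top.
  by apply: censoring_greatest => //; exact: rkf_incr.
have h2 : word_op w0 K bot <= word_op w0 (word_op w (rkf v)) bot.
  by apply: censoring_least => //; exact: rkf_incr.
pose h z := \sum_(u in S) kappa * rkf u z + (-1) * K z.
have hi : incr h.
  move=> y x y0 x0 yx; have := infl x y x0 y0 yx.
  under eq_bigr do rewrite mulrBr.
  by rewrite sumrB /h !mulN1r; lra.
have := word_op_incr w0 hi bot0 top0 (botmin _ top0).
rewrite /h !word_opD !word_opZ !word_op_sum !mulN1r => h3.
apply: (@le_trans _ _ (\sum_(u in S) kappa * gap w0 u)).
  under eq_bigr do rewrite /gap mulrBr -!word_opZ.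
  by rewrite sumrB; lra.
apply: (@le_trans _ _ (\sum_(u in S) kappa * B)).
  by apply: ler_sum => u _; rewrite ler_wpM2l.
rewrite sumr_const -[leLHS]mulr_natr -mulrA [B * _]mulrC mulrA.
by rewrite ler_wpM2r // ler_wpM2l // ler_nat.
Qed.

Lemma flatten_nseqSr (A : Type) m (s : seq A) :
  flatten (nseq m.+1 s) = flatten (nseq m s) ++ s.
Proof. by elim: m => [|m IHm] /=; [rewrite cats0|rewrite -catA -IHm]. Qed.

Lemma gap_iter (Q : T -> pred T) (S : T -> {set T}) w (kappa : R) (M m : nat) v :
  0 <= kappa -> kappa * M%:R <= 2^-1 -> (forall v, #|S v| <= M)%N ->
  (forall v x y, 0 < mu x -> 0 < mu y -> cle y x ->
   word_op [seq u <- w | Q v u] (rkf v) x - word_op [seq u <- w | Q v u] (rkf v) y <=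
     \sum_(u in S v) kappa * (rkf u x - rkf u y)) ->
  gap (flatten (nseq m w)) v <= 2^-1 ^+ m * q%:R.
Proof.
move=> k0 kM SM infl; elim: m v => [|m IHm] v.
  rewrite expr0 mul1r /gap /= /rkf lerBlDr -natrD ler_nat.
  by rewrite (leq_trans (ltnW (rk_lt _ _))) // leq_addr.
have B0 : (0 : R) <= 2^-1 ^+ m * q%:R by rewrite mulr_ge0 // exprn_ge0 // invr_ge0.
rewrite flatten_nseqSr exprS -mulrA.
by apply: le_trans (gap_step k0 B0 (SM v) (infl v) IHm) _; rewrite ler_wpM2r.
Qed.

Hypothesis mu_sum1 : \sum_x mu x = 1.

(** A function [g] with values 1 and -1 becomes increasing, and so does its
    opposite, when twice the sum of the ranks is added to it.  The variation of
    [word_op w g] is therefore controlled by that of the sum of the ranks. *)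
Lemma word_op_tv w x : 0 < mu x ->
  \sum_y `|word_op w (fun z => (z == y)%:R) x - mu y| <= 4 * \sum_v gap w v.
Proof.
move=> x0; have [top0 topmax] := topP; have [bot0 botmin] := botP.
set p := fun y => word_op w (fun z => (z == y)%:R) x.
pose g y : R := if mu y <= p y then 1 else -1.
have gE : word_op w g x = \sum_y p y * g y.
  transitivity (word_op w (fun z => \sum_y g y * (z == y)%:R) x).
    apply: eq_word_op => // z _; rewrite (bigD1 z) //= eqxx mulr1 big1 ?addr0 //.
    by move=> y /negbTE yz; rewrite eq_sym yz mulr0.
  rewrite word_op_sum; apply: eq_bigr => y _.
  by rewrite word_opZ mulrC.
have stat : \sum_y mu y * word_op w g y = \sum_y mu y * g y.
  have E h : \sum_y mu y * h y = dotp (fun=> 1) h.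
    by apply: eq_bigr => y _; rewrite mulr1.
  by rewrite !E word_op_dotp; apply: eq_dotpl => y y0; rewrite word_op_cst.
have -> : \sum_y `|p y - mu y| = \sum_y mu y * (word_op w g x - word_op w g y).
  under [RHS]eq_bigr do rewrite mulrBr.
  rewrite sumrB -mulr_suml mu_sum1 mul1r stat gE -sumrB; apply: eq_bigr => y _.
  rewrite -mulrBl /g; case: leP => le.
    by rewrite mulr1 ger0_norm // subr_ge0.
  by rewrite mulrN1 ltr0_norm // subr_lt0.
pose G y := \sum_v rkf v y.
have near f : (forall z z', `|f z - f z'| <= 2) ->
    forall y, 0 < mu y -> word_op w f y - word_op w f top <=
      2 * (word_op w G top - word_op w G y).
  move=> f2 y y0.
  have hi : incr (fun z => f z + 2 * G z).
    move=> z z' z0 z'0 zz'; have [->//|ne] := eqVneq z z'.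
    have : G z + 1 <= G z'.
      have [u neu] : exists u, z u != z' u.
        apply/existsP; apply: contraR ne => /existsPn h.
        by apply/eqP/ffunP => u; apply/eqP; move: (h u); rewrite negbK.
      rewrite /G (bigD1 u) //= [leRHS](bigD1 u) //= addrAC lerD //.
        rewrite /rkf natr1 ler_nat ltn_neqAle; move/cleP: zz' => -> /=.
        by rewrite andbT; apply: contra neu => /eqP/rk_inj ->.
      by apply: ler_sum => v' _; exact: rkf_incr.
    by have := ler_normlW (f2 z z'); lra.
  have := word_op_incr w hi y0 top0 (topmax _ y0).
  by rewrite !word_opD !word_opZ; lra.
have g2 z z' : `|g z - g z'| <= 2.
  by rewrite /g ler_norml; case: ifP; case: ifP; lra.
have Gi : incr (word_op w G).
  by apply: word_op_incr => y z y0 z0 yz; apply: ler_sum => v _; exact: rkf_incr.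
have GE : word_op w G top - word_op w G bot = \sum_v gap w v.
  by rewrite /G !word_op_sum -sumrB.
rewrite -GE -[leRHS]mul1r -[X in _ <= X * _]mu_sum1 mulr_suml.
apply: ler_sum => y _; have [y0|] := boolP (0 < mu y); last first.
  by rewrite lt_neqAle mu_ge0 andbT negbK => /eqP <-; rewrite !mul0r.
rewrite ler_wpM2l ?mu_ge0 //.
have := near g g2 x x0.
have ng2 z z' : `| - 1 * g z - - 1 * g z'| <= 2.
  by rewrite -mulrBr normrM normrN1 mul1r.
have := near (fun z => - 1 * g z) ng2 y y0; rewrite !word_opZ !mulN1r.
have := Gi _ _ bot0 x0 (botmin _ x0); have := Gi _ _ bot0 y0 (botmin _ y0).
lra.
Qed.

End Ranked.
End SpinChain.

(** * Spin systems that are monotone, connected and marginally bounded *)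

Section FromHypotheses.
Variables (R : realType) (T : finType) (q : nat).
Notation config := {ffun T -> 'I_q}.
Variable mu : config -> R.
Hypothesis mu_ge0 : forall x, 0 <= mu x.

Lemma sum_gt0_exists (I : finType) (Q : pred I) (F : I -> R) :
  0 < \sum_(i | Q i) F i -> exists2 i, Q i & 0 < F i.
Proof.
move=> s0; have [/existsP[i /andP[]]|/existsPn h] := boolP [exists i, Q i && (0 < F i)].
  by exists i.
suff : \sum_(i | Q i) F i <= 0 by rewrite leNgt s0.
apply: sumr_le0 => i Qi; rewrite leNgt.
by move: (h i); rewrite Qi.
Qed.

Lemma restr_eq (A : {set T}) (x y : config) v :
  restr A x = restr A y -> v \in A -> x v = y v.
Proof. by move=> /ffunP h vA; move: (h (exist _ v vA)); rewrite !ffunE. Qed.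

Lemma cond_feasibleP (A : {set T}) (tau : pinning q A) xi :
  xi \in cond_feasible mu tau ->
  exists x, [/\ 0 < mu x, restr A x = tau & restr (~: A) x = xi].
Proof.
rewrite inE /cond_prob => h.
have : 0 < \sum_(x | (restr A x == tau) && (restr (~: A) x == xi)) mu x.
  rewrite lt_neqAle sumr_ge0 // andbT eq_sym; apply: contraTneq h => ->.
  by rewrite mul0r ltxx.
by case/sum_gt0_exists => x /andP[/eqP ? /eqP ?] ?; exists x.
Qed.

Lemma restr_cond_feasible (A : {set T}) x : 0 < mu x ->
  restr (~: A) x \in cond_feasible mu (restr A x).
Proof.
move=> x0; rewrite inE /cond_prob divr_gt0 //.
  rewrite (bigD1 x) /= ?eqxx //= ltr_pwDl // sumr_ge0 //.
by have := feasible_restr mu_ge0 A x0; rewrite inE.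
Qed.

Lemma fiber_connected : totally_connected mu ->
  forall (D : {set T}) x y (Q : config -> Prop),
  0 < mu x -> 0 < mu y -> agree D x y -> Q x ->
  (forall s t u, 0 < mu s -> 0 < mu t -> u \in D -> agree [set u] s t ->
     Q s -> Q t) ->
  Q y.
Proof.
move=> tc D x y Q x0 y0 xy Qx step.
pose A := ~: D; pose tau := restr A x.
have ytau : restr A y = tau.
  by apply/eqP; rewrite eq_sym restr_agree.
have xf : restr (~: A) x \in cond_feasible mu tau by exact: restr_cond_feasible.
have yf : restr (~: A) y \in cond_feasible mu tau.
  by rewrite -ytau; exact: restr_cond_feasible.
have uniq_ext (s t : config) : restr A s = restr A t -> restr (~: A) s = restr (~: A) t -> s = t.
  move=> h h'; apply/ffunP => v.
  have [vA|vA] := boolP (v \in A); first exact: (restr_eq h).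
  by apply: (restr_eq h'); rewrite inE.
have tf : tau \in feasible mu A by exact: feasible_restr.
case/connectP: (tc A tau tf _ _ xf yf) => p.
have : forall s, 0 < mu s -> restr A s = tau ->
    restr (~: A) s = restr (~: A) x -> Q s.
  by move=> s _ sA sx; rewrite (uniq_ext s x).
move: (restr (~: A) x) xf => xi xf Qxi pathp lastp.
suff : forall s, 0 < mu s -> restr A s = tau -> restr (~: A) s = last xi p -> Q s.
  by apply.
elim: p xi xf Qxi pathp {lastp} => [//|xi' p IHp] xi xf Qxi /= /andP[flip].
apply: IHp; first by case/and3P: flip.
move=> t t0 tA txi'.
case/and3P: flip => _ _ /cards1P[v vE].
have [s [s0 sA sxi]] := cond_feasibleP xf.
have vD : val v \in D by have := valP v; rewrite /A !inE negbK.
apply: (step s t (val v)) => //; last exact: Qxi.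
apply/agreeP => w; rewrite inE => wv.
have [wA|wA] := boolP (w \in A).
  by apply: (restr_eq _ wA); rewrite sA.
rewrite -finset.in_setC in wA.
have : exist _ w wA \notin [set v0 | xi v0 != xi' v0].
  by rewrite vE inE; apply: contra wv => /eqP <-.
by rewrite inE negbK -sxi -txi' !ffunE => /eqP.
Qed.

Lemma site_lower_bound b : marginally_bounded mu b ->
  forall u x y, 0 < mu x -> 0 < mu y -> agree [set u] x y ->
  b <= kern mu [set u] x y.
Proof.
move=> mb u x y x0 y0 xy.
have := mb (~: [set u]) (restr (~: [set u]) x) u (y u).
rewrite cond_probE // (_ : cexp _ _ _ _ = kern mu [set u] x y); last first.
  rewrite (site_lawE mu_ge0); congr (kern _ _ _ _); apply/ffunP => v.
  by rewrite ffunE; case: eqVneq => [->//|vu]; move/agreeP: xy => -> //; rewrite inE.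
apply; first exact: feasible_restr.
  by rewrite !inE negbK.
exact: kern_self_gt0.
Qed.

(** Counting the spins below a given one turns the linear orders into numbers,
    which can be summed and averaged. *)
Lemma monotone_ranks : monotone_dist mu ->
  exists rk : T -> 'I_q -> nat, [/\ (forall v, injective (rk v)),
    (forall v s, (rk v s < q)%N) & site_monotone mu rk].
Proof.
move=> [ord [ordP mono]].
pose rk v s := #|[set s' | ord v s' s && (s' != s)]|.
have rk_lt v s s' : ord v s s' -> s != s' -> (rk v s < rk v s')%N.
  have [_ anti tr] := ordP v => ss' ne; apply: proper_card; apply/properP; split.
    apply/fintype.subsetP => t; rewrite !inE => /andP[ts tns].
    rewrite (tr _ _ _ ts ss') /=; apply: contra tns => /eqP tE.
    by rewrite tE in ts *; apply/eqP/anti; rewrite ts ss'.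
  by exists s; rewrite !inE ?ss' ?ne ?eqxx ?andbF.
have rkE v s s' : (rk v s <= rk v s')%N = ord v s s'.
  have [tot _ _] := ordP v; have [<-|ne] := eqVneq s s'.
    by rewrite leqnn; have := tot s s; rewrite orbb => ->.
  have /orP[h|h] := tot s s'; first by rewrite h ltnW // rk_lt.
  have lt : (rk v s' < rk v s)%N by apply: rk_lt => //; rewrite eq_sym.
  rewrite leqNgt lt; apply/esym/negbTE/negP => h'.
  by have := rk_lt v _ _ h' ne; rewrite ltnNge ltnW.
exists rk; split.
- move=> v s s' E; apply/eqP; apply: contraT => ne.
  have [tot _ _] := ordP v; have /orP[h|h] := tot s s'.
    by have := rk_lt v _ _ h ne; rewrite E ltnn.
  by have := rk_lt v _ _ h; rewrite eq_sym ne E ltnn => /(_ isT).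
- move=> v s; rewrite -[ltnRHS](card_ord q) -cardsT; apply: proper_card.
  apply/properP; split; first exact: finset.subsetT.
  by exists s; rewrite !inE ?eqxx ?andbF.
- move=> u x y x0 y0 xy E Ei.
  rewrite /site_op -!cond_probE //; apply: mono; try exact: feasible_restr.
    by move=> v; rewrite !ffunE -rkE; move/cleP: xy.
  by move=> s t st; apply: Ei; apply/cleP => v; rewrite rkE.
Qed.

(** Reversing all the orders preserves stochastic monotonicity, by taking
    complements of events. *)
Lemma exists_greatest (rk : T -> 'I_q -> nat) :
  (forall v, injective (rk v)) -> (forall v s, (rk v s < q)%N) ->
  site_monotone mu rk -> totally_connected mu ->
  forall x, 0 < mu x -> exists z, greatest mu rk z.
Proof.
move=> rk_inj rk_lt mono tc x x0; pose rk' v s := (q - rk v s)%N.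
have rk'E s t : cle rk' s t = cle rk t s.
  by apply/cleP/cleP => h v; move: (h v) (rk_lt v (s v)) (rk_lt v (t v)); rewrite /rk'; lia.
have rk'_inj v : injective (rk' v).
  move=> s t E; apply: (@rk_inj v).
  by move: E (rk_lt v s) (rk_lt v t); rewrite /rk'; lia.
have mono' : site_monotone mu rk'.
  move=> u s t s0 t0; rewrite rk'E => ts E Ei.
  have Ci s' t' : cle rk s' t' -> predC E s' -> predC E t'.
    by rewrite -rk'E => h; apply: contra; exact: Ei.
  have := mono u t s t0 s0 ts _ Ci.
  have CE z : 0 < mu z -> site_op mu u (fun y => (predC E y)%:R) z =
      1 - site_op mu u (fun y => (E y)%:R) z.
    move=> z0; rewrite /site_op -mulN1r -cexpZ -(cexp_cst mu_ge0 [set u] 1 z0) -cexpD.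
    apply: eq_cexp => // y _ _ /=; rewrite cexp_cst //.
    by case: (E y); rewrite /= ?mulr0 ?mulr1 ?subrr ?addr0.
  by rewrite !CE // lerD2l lerN2.
have [z [z0 zmin]] := exists_least mu_ge0 rk'_inj mono' (fiber_connected tc) x0.
by exists z; split=> // y y0; rewrite -rk'E zmin.
Qed.

(** * Transition matrices act on functions as words of updates *)

Lemma sum_support (F : config -> R) :
  \sum_(y in gibbs_support mu) F y = \sum_(j < #|gibbs_support mu|) F (enum_val j).
Proof. by rewrite big_enum_val. Qed.

Definition represents (P : transition mu) w := forall f i,
  \sum_j P i j * f (enum_val j) = word_op mu w f (enum_val i).

Lemma represents_heat_bath v : represents (heat_bath mu v) [:: v].
Proof.
move=> f i /=; rewrite /site_op /cexp.
under eq_bigr do rewrite mxE cond_probE //.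
rewrite -(sum_support
  (fun y => cexp mu [set v] (fun z => (pred1 y z)%:R) (enum_val i) * f y)).
rewrite big_mkcond; apply: eq_bigr => y _ /=.
have E : cexp mu [set v] (fun z => (z == y)%:R) (enum_val i) =
    kern mu [set v] (enum_val i) y.
  rewrite /cexp (bigD1 y) //= eqxx mulr1 big1 ?addr0 // => z /negbTE ->.
  by rewrite mulr0.
rewrite E inE; case: ifPn => // y0.
by rewrite kern0 // mul0r.
Qed.

Lemma represents1 : represents 1 [::].
Proof.
move=> f i /=; rewrite (bigD1 i) //= mxE eqxx mul1r big1 ?addr0 // => j ji.
by rewrite mxE eq_sym (negbTE ji) mul0r.
Qed.

Lemma representsM P P' w w' :
  represents P w -> represents P' w' -> represents (P * P') (w ++ w').
Proof.
move=> h h' f i; rewrite word_op_cat -h.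
under [RHS]eq_bigr do rewrite -h' mulr_sumr.
rewrite exchange_big; apply: eq_bigr => j _ /=.
by rewrite mxE mulr_suml; apply: eq_bigr => k _; rewrite mulrA.
Qed.

Lemma represents_prod w : represents (\prod_(v <- w) heat_bath mu v) w.
Proof.
elim: w => [|v w IHw]; first by rewrite big_nil; exact: represents1.
by rewrite big_cons -cat1s; apply: representsM IHw; exact: represents_heat_bath.
Qed.

Lemma represents_scan phi t :
  represents (systematic_scan mu phi ^+ t) (flatten (nseq t (phi ++ rev phi))).
Proof.
elim: t => [|t IHt]; first by rewrite expr0; exact: represents1.
rewrite exprS /=; apply: representsM IHt.
by apply: representsM; exact: represents_prod.
Qed.

Lemma flatten_nseqM (A : Type) k j (s : seq A) :
  flatten (nseq k (flatten (nseq j s))) = flatten (nseq (k * j) s).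
Proof. by elim: k => [//|k IHk] /=; rewrite IHk mulSn nseqD flatten_cat. Qed.

Lemma filter_flatten_nseq (A : Type) (Q : pred A) k (s : seq A) :
  [seq u <- flatten (nseq k s) | Q u] = flatten (nseq k [seq u <- s | Q u]).
Proof. by elim: k => [//|k IHk] /=; rewrite filter_cat IHk. Qed.

Lemma size_flatten_nseq (A : Type) k (s : seq A) :
  size (flatten (nseq k s)) = (k * size s)%N.
Proof. by elim: k => [//|k IHk] /=; rewrite size_cat IHk mulSn. Qed.

Hypothesis mu_sum1 : \sum_x mu x = 1.

(** One superstep consists of [k] groups of [q * M] double passes, since the
    ranks in a block of at most [M] sites sum to at most [q * M].  Restricted to a
    block, a group has at most [q * M * (M + M)] updates, whence the value of
    [p]. *)
Theorem scan_mixing (b p delta : R) (phi : seq T) (D S : T -> {set T}) (M k m : nat) :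
  0 <= b <= 1 -> marginally_bounded mu b -> monotone_dist mu -> totally_connected mu ->
  perm_eq phi (enum T) ->
  (forall v, v \in D v) -> (forall v, D v \subset S v) -> (forall v, #|S v| <= M)%N ->
  (forall v u, u \in D v -> law_local mu (S v) u) ->
  (forall v s t u, 0 < mu s -> 0 < mu t -> u \notin D v -> agree [set u] s t ->
    \sum_a `|cexp mu (D v) (fun z => (z v == a)%:R) s
             - cexp mu (D v) (fun z => (z v == a)%:R) t| <= delta) ->
  0 <= delta -> p = b ^+ (q * M * (M + M)) ->
  (2 * ((1 - p) ^+ k * q%:R) + q%:R * delta) * q%:R * M%:R <= 2^-1 ->
  max_tv_to_gibbs (systematic_scan mu phi ^+ (m * (k * (q * M)))) <=
    2 * (#|T|%:R * (2^-1 ^+ m * q%:R)).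
Proof.
move=> /andP[b0 b1] mb md tc phiP vD DS SM law decay delta0 pE small.
have [rk [rk_inj rk_lt mono]] := monotone_ranks md.
have conn := fiber_connected tc.
have bound := site_lower_bound mb.
set w1 := phi ++ rev phi; set j := (q * M)%N.
apply/bigmax_leP; split.
  by rewrite !mulr_ge0 // exprn_ge0 // invr_ge0.
move=> i _; set x := enum_val i.
have x0 : 0 < mu x by have := enum_valP i; rewrite inE.
have [top topP] := exists_greatest rk_inj rk_lt mono tc x0.
have [bot botP] := exists_least mu_ge0 rk_inj mono conn x0.
set w := flatten (nseq m (flatten (nseq k (flatten (nseq j w1))))).
have tvE : tv_dist ((systematic_scan mu phi ^+ (m * (k * j))) i)
    (fun l => mu (enum_val l)) =
    2^-1 * \sum_(y in gibbs_support mu) `|word_op mu w (fun z => (z == y)%:R) x - mu y|.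
  rewrite sum_support; congr (_ * _); apply: eq_bigr => l _.
  congr (`|_ - _|).
  have := represents_scan phi (m * (k * j)) (fun z => (z == enum_val l)%:R) i.
  rewrite (bigD1 l) //= eqxx mulr1 big1 ?addr0 => [->|l' ll'].
    by rewrite /w !flatten_nseqM mulnA.
  by rewrite (inj_eq enum_val_inj) (negbTE ll') mulr0.
rewrite tvE.
have tv4 := word_op_tv mu_ge0 rk_inj mono topP botP mu_sum1 w x0.
have le_sum : \sum_(y in gibbs_support mu) `|word_op mu w (fun z => (z == y)%:R) x - mu y|
    <= \sum_y `|word_op mu w (fun z => (z == y)%:R) x - mu y|.
  by rewrite [leRHS](bigID (mem (gibbs_support mu))) /= lerDl sumr_ge0.
suff gapv v : gap mu rk top bot w v <= 2^-1 ^+ m * q%:R.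
  have gs : \sum_v gap mu rk top bot w v <= #|T|%:R * (2^-1 ^+ m * q%:R).
    by rewrite mulr_natl -sumr_const; apply: ler_sum.
  have := le_trans le_sum tv4; lra.
pose kappa : R := (2 * ((1 - p) ^+ k * q%:R) + q%:R * delta) * q%:R.
have p0 : 0 <= p by rewrite pE exprn_ge0.
have p1 : p <= 1 by rewrite pE exprn_ile1.
have kappa0 : 0 <= kappa.
  by rewrite /kappa mulr_ge0 // addr_ge0 // !mulr_ge0 // exprn_ge0 // subr_ge0.
apply: (@gap_iter _ _ _ _ mu_ge0 _ rk_inj mono rk_lt top bot topP botP
  (fun v => mem (D v)) S _ kappa M) => // {}v s t s0 t0 ts.
rewrite !filter_flatten_nseq; set wD := [seq u <- w1 | _].
have wDD : {subset wD <= D v} by move=> u; rewrite mem_filter => /andP[].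
have DwD : {subset D v <= wD}.
  move=> u uD; rewrite mem_filter /= uD /= mem_cat.
  by rewrite (perm_mem phiP) mem_enum.
have DM : (#|D v| <= M)%N by apply: leq_trans (SM v); exact: subset_leq_card.
have sizewD : (size wD <= M + M)%N.
  have sf : (size [seq u <- phi | mem (D v) u] <= M)%N.
    rewrite (perm_size (perm_filter _ phiP)).
    apply: leq_trans DM; rewrite cardE.
    apply: uniq_leq_size => [|u]; first exact: filter_uniq (enum_uniq _).
    by rewrite mem_filter !mem_enum => /andP[].
  by rewrite /wD filter_cat filter_rev size_cat size_rev leq_add.
have near z : 0 < mu z ->
    `|word_op mu (flatten (nseq k (flatten (nseq j wD)))) (rkf R rk v) z
      - cexp mu (D v) (rkf R rk v) z| <= (1 - p) ^+ k * q%:R.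
  move=> z0; rewrite -[q%:R]subr0.
  apply: (word_op_near_cexp mu_ge0 rk_inj mono conn b0 bound) => //.
  - move=> y; rewrite /rksum; apply: (@leq_trans (\sum_(u in D v) q)).
      by apply: leq_sum => u _; exact: ltnW.
    by rewrite sum_nat_const mulnC leq_mul2l DM orbT.
  - rewrite pE size_flatten_nseq; apply: ler_wiXn2l => //.
    by rewrite leq_mul2l sizewD orbT.
  - by move=> y; rewrite /rkf ler0n ler_nat ltnW.
have decay' s' t' u : 0 < mu s' -> 0 < mu t' -> u \notin D v -> agree [set u] s' t' ->
    cexp mu (D v) (rkf R rk v) s' - cexp mu (D v) (rkf R rk v) t' <= q%:R * delta.
  move=> s'0 t'0 uD st.
  have E z : cexp mu (D v) (rkf R rk v) z =
      \sum_a (rk v a)%:R * cexp mu (D v) (fun y => (y v == a)%:R) z.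
    under [RHS]eq_bigr do rewrite -cexpZ.
    rewrite /cexp exchange_big; apply: eq_bigr => y _ /=.
    rewrite -mulr_sumr; congr (_ * _); rewrite (bigD1 (y v)) //= eqxx mulr1.
    by rewrite big1 ?addr0 // => a /negbTE; rewrite eq_sym => ->; rewrite mulr0.
  rewrite !E -sumrB.
  apply: le_trans (ler_wpM2l (ler0n R q) (decay v s' t' u s'0 t'0 uD st)).
  rewrite mulr_sumr; apply: ler_sum => a _; rewrite -mulrBr.
  apply: (@le_trans _ _ ((rk v a)%:R * `|cexp mu (D v) (fun y => (y v == a)%:R) s'
     - cexp mu (D v) (fun y => (y v == a)%:R) t'|)).
    by rewrite ler_wpM2l // ler_norm.
  by rewrite ler_wpM2r // ler_nat ltnW.
apply: (influence mu_ge0 rk_inj mono conn rk_lt (D := D v)) => //.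
- move=> u /flattenP[w2 /nseqP[-> _]] /flattenP[w3 /nseqP[-> _]]; exact: wDD.
- by apply: (fintype.subsetP (DS v)).
- exact: law.
- by rewrite mulr_ge0.
Qed.

End FromHypotheses.

(** * Weights of lattice spin systems *)

Section GibbsMarkov.
Variables (R : realType) (d q : nat) (S : spin_system R q).
Notation site := (site d).
Local Open Scope fset_scope.

Definition edge_weight s t : R := fine (expeR (edge_pot S s t)).

Definition total_weight (L D : {fset site}) (sp : site -> 'I_q) : R :=
  (\prod_(u <- L) \prod_(v <- L | next_site u v) edge_weight (sp u) (sp v)) *
  (\prod_(u <- L) \prod_(v <- D | adj u v) edge_weight (sp u) (sp v)) *
  \prod_(u <- L) expR (spin_pot S (sp u)).

Lemma edge_weight_ge0 s t : 0 <= edge_weight s t.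
Proof. by rewrite fine_ge0 // expeR_ge0. Qed.

Lemma total_weight_ge0 L D sp : 0 <= total_weight L D sp.
Proof.
rewrite /total_weight !mulr_ge0 //.
- by apply: prodr_ge0 => u _; apply: prodr_ge0 => v _; exact: edge_weight_ge0.
- by apply: prodr_ge0 => u _; apply: prodr_ge0 => v _; exact: edge_weight_ge0.
- by apply: prodr_ge0 => u _; exact: expR_ge0.
Qed.

Lemma sume_noty (I : Type) (r : seq I) (P : pred I) (F : I -> \bar R) :
  (forall i, F i != +oo%E) -> (\sum_(i <- r | P i) F i != +oo)%E.
Proof.
move=> h; elim/big_rec: _ => // i x _; move: (h i).
by case: (F i) x => [r'| |] [s| |].
Qed.

Lemma fine_expeR_sum (I : Type) (r : seq I) (P : pred I) (F : I -> \bar R) :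
  (forall i, F i != +oo%E) ->
  fine (expeR (\sum_(i <- r | P i) F i)%E) = \prod_(i <- r | P i) fine (expeR (F i)).
Proof.
move=> h; elim: r => [|i r IHr]; first by rewrite !big_nil /= expR0.
rewrite !big_cons; case: (P i) => //; rewrite -IHr expeRD.
have := sume_noty r P h; move: (h i).
case: (F i) => [a| |] //; case: (\sum_(_ <- _ | _) _)%E => [c| |] //= _ _.
all: by rewrite ?mulr0 ?mul0r.
Qed.

(** No term of the Hamiltonian is [+oo], so its exponential is a product over
    the edges.  A total assignment [sp] of spins replaces the configuration and
    the boundary condition, which lets weights of different regions be
    compared. *)
Lemma weightE (L : {fset site}) (tau : {fmap site -> 'I_q})
    (sigma : {ffun L -> 'I_q}) sp :
  (forall u : L, sp (val u) = sigma u) ->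
  (forall v : domf tau, sp (val v) = tau v) ->
  weight S tau sigma = total_weight L (domf tau) sp.
Proof.
move=> spL sptau; rewrite /weight /hamiltonian.
set a := (\sum_u _)%E; set b := (\sum_u _)%E; set c := (\sum_v _)%E.
have e0 s t : edge_pot S s t != +oo%E := edge_pot_nooy S s t.
have aE : fine (expeR a) =
    \prod_(u <- L) \prod_(v <- L | next_site u v) edge_weight (sp u) (sp v).
  rewrite /a fine_expeR_sum => [|u]; last exact: sume_noty.
  rewrite big_seq_fsetE; apply: eq_bigr => u _.
  rewrite fine_expeR_sum // big_seq_fsetE; apply: eq_bigr => v _.
  by rewrite !spL.
have bE : fine (expeR b) =
    \prod_(u <- L) \prod_(v <- domf tau | adj u v) edge_weight (sp u) (sp v).
  rewrite /b fine_expeR_sum => [|u]; last exact: sume_noty.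
  rewrite big_seq_fsetE; apply: eq_bigr => u _.
  rewrite fine_expeR_sum // big_seq_fsetE; apply: eq_bigr => v _.
  by rewrite spL sptau.
have cE : fine (expeR c) = \prod_(u <- L) expR (spin_pot S (sp u)).
  rewrite /c fine_expeR_sum // big_seq_fsetE; apply: eq_bigr => u _.
  by rewrite spL.
rewrite /total_weight -aE -bE -cE.
have ay : a != +oo%E by apply: sume_noty => u; exact: sume_noty.
have by_ : b != +oo%E by apply: sume_noty => u; exact: sume_noty.
have cy : c != +oo%E by exact: sume_noty.
move: a b c ay by_ cy {aE bE cE} => [a| |] [b| |] [c| |] //= _ _ _.
all: rewrite ?mulr0 ?mul0r //.
by rewrite -!expRD; congr expR; ring.
Qed.

Lemma next_site_asym (u v : site) : next_site u v -> ~~ next_site v u.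
Proof.
move=> /existsP[i /eqP ->]; apply/negP => /existsP[j /eqP uE].
have : (delta_mx 0 i + delta_mx 0 j = 0 :> site)%R.
  by apply: (addrI u); rewrite addr0 addrA -uE.
move=> /matrixP/(_ 0 i); rewrite !mxE !eqxx /=.
by case: (i == j).
Qed.

(** The edges that join [Lam] to the rest of [V] are interior in the left-hand
    side and boundary edges in the first factor.  The former are visited along
    their positive orientation and the latter from [Lam], which is the same by
    symmetry of the potential. *)
Lemma total_weight_split (V Lam D : {fset site}) sp : Lam `<=` V ->
  (forall v, v \in D -> v \notin V) ->
  total_weight V D sp =
    total_weight Lam [fset v in V `|` D | boundary Lam v] sp *
    total_weight (V `\` Lam) D sp.
Proof.
move=> sub disj; set D' := [fset v in _ | _]; set O := V `\` Lam.
have LV u : u \in Lam -> u \in V by exact: (fsubsetP sub).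
have split_cond (P : pred site) (F : site -> R) :
    \prod_(u <- V | P u) F u = \prod_(u <- Lam | P u) F u * \prod_(u <- O | P u) F u.
  rewrite (big_fsetIDcond _ (mem Lam)) /=; congr (_ * _); apply: eq_fbigl_cond => u.
    by rewrite !inE; case: (boolP (u \in Lam)) => [/LV ->|]; rewrite ?andbF.
  by rewrite !inE /=; congr (_ && _); exact: andbC.
have split := split_cond predT.
set k := fun u v => edge_weight (sp u) (sp v).
have kC u v : k u v = k v u by rewrite /k /edge_weight edge_pot_sym.
have across : (\prod_(u <- Lam) \prod_(v <- O | next_site u v) k u v) *
    (\prod_(u <- O) \prod_(v <- Lam | next_site u v) k u v) =
    \prod_(u <- Lam) \prod_(v <- O | adj u v) k u v.
  rewrite [X in _ * X](exchange_big_dep predT) //= -big_split /=.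
  apply: eq_bigr => u _; under [X in _ * X]eq_bigr do rewrite kC.
  rewrite (big_mkcond (fun v => next_site u v)) (big_mkcond (fun v => next_site v u)).
  rewrite -big_split [RHS]big_mkcond; apply: eq_bigr => v _ /=.
  rewrite /adj; have [uv|] := boolP (next_site u v).
    by rewrite (negbTE (next_site_asym uv)) mulr1.
  by rewrite mul1r.
have boundaryD' : \prod_(u <- Lam) \prod_(v <- D' | adj u v) k u v =
    (\prod_(u <- Lam) \prod_(v <- O | adj u v) k u v) *
    (\prod_(u <- Lam) \prod_(v <- D | adj u v) k u v).
  rewrite -big_split /= !big_seq; apply: eq_bigr => u uL.
  have bu v : adj u v -> v \notin Lam -> boundary Lam v.
    by move=> uv vL; rewrite /boundary vL; apply/existsP; exists [` uL].
  rewrite (big_fsetIDcond _ (mem V)) /=; congr (_ * _); apply: eq_fbigl_cond => v.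
    rewrite !inE /=; case: (boolP (adj u v)) => uv; rewrite ?andbF ?andbT //.
    case: (boolP (v \in V)) => vV; rewrite ?andbF //= !andbT.
    by apply/idP/idP => [/andP[]//|]; exact: bu.
  rewrite !inE /=; case: (boolP (adj u v)) => uv; rewrite ?andbF ?andbT //.
  case: (boolP (v \in D)) => vD.
    have vV := disj v vD; rewrite vV orbT /= andbT; apply: bu => //.
    by apply: contra vV; exact: LV.
  by rewrite orbF; case: (v \in V); rewrite ?andbF.
rewrite /total_weight -/k boundaryD' -across.
rewrite [\prod_(u <- V) \prod_(v <- V | _) _]split.
under eq_bigr do rewrite split_cond.
under [X in _ * X * _ * _]eq_bigr do rewrite split_cond.
rewrite !big_split /= !split.
by ring.
Qed.

(** * The spatial Markov property *)

Variables (V : {fset site}) (tau : {fmap site -> 'I_q}) (s0 : 'I_q).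
Hypothesis tau_out : forall v, v \in domf tau -> v \notin V.
Local Notation mu := (gibbs S tau (L := V)).

(** [s0] is a default value away from [V] and from the boundary condition. *)
Definition extend (x : {ffun V -> 'I_q}) (u : site) : 'I_q :=
  if insub u is Some w then x w else odflt s0 (tau.[? u]%fmap).

Lemma extend_in x (u : V) : extend x (val u) = x u.
Proof. by rewrite /extend valK. Qed.

Lemma extend_out x y u : u \notin V -> extend x u = extend y u.
Proof. by move=> uV; rewrite /extend insubN. Qed.

Lemma extend_tau x (v : domf tau) : extend x (val v) = tau v.
Proof.
by rewrite /extend insubN ?tau_out ?(valP v) // -Some_fnd.
Qed.

Lemma weight_extend x : weight S tau x = total_weight V (domf tau) (extend x).
Proof. by apply: weightE => u; rewrite ?extend_in ?extend_tau. Qed.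

Lemma weight_ge0 (L : {fset site}) (t : {fmap site -> 'I_q}) (x : {ffun L -> 'I_q}) :
  0 <= weight S t x.
Proof. by rewrite fine_ge0 // expeR_ge0. Qed.

Lemma partition_ge0 (L : {fset site}) (t : {fmap site -> 'I_q}) :
  0 <= partition_function S L t.
Proof. by apply: sumr_ge0 => x _; exact: weight_ge0. Qed.

Lemma gibbs_ge0 (L : {fset site}) (t : {fmap site -> 'I_q}) (x : {ffun L -> 'I_q}) :
  0 <= gibbs S t x.
Proof. by rewrite divr_ge0 ?weight_ge0 ?partition_ge0. Qed.

Lemma gibbs_sum1 (L : {fset site}) (t : {fmap site -> 'I_q}) :
  0 < partition_function S L t -> \sum_(x : {ffun L -> 'I_q}) gibbs S t x = 1.
Proof. by move=> Z0; rewrite -mulr_suml divff // gt_eqF. Qed.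

Lemma weight_gt0 x : 0 < mu x -> 0 < weight S tau x.
Proof.
move=> x0; rewrite lt_neqAle weight_ge0 andbT; apply: contraTneq x0 => E.
by rewrite /gibbs -E mul0r ltxx.
Qed.

Variable Lam : {fset site}.
Hypothesis sub : Lam `<=` V.

Definition block : {set V} := [set v | val v \in Lam]%SET.

Definition bdry := [fset v in V `|` domf tau | boundary Lam v].

Definition induced_bc (x : {ffun V -> 'I_q}) : {fmap site -> 'I_q} :=
  [fmap v : bdry => extend x (val v)]%fmap.

Definition fill (x : {ffun V -> 'I_q}) (eta : {ffun Lam -> 'I_q}) : {ffun V -> 'I_q} :=
  [ffun v => if insub (val v) is Some w then eta w else x v].

Definition inner (x : {ffun V -> 'I_q}) : {ffun Lam -> 'I_q} :=
  [ffun w => x (fincl sub w)].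

Lemma fill_in x eta (v : V) (w : Lam) : val v = val w -> fill x eta v = eta w.
Proof. by move=> vw; rewrite ffunE vw valK. Qed.

Lemma fill_out x eta (v : V) : val v \notin Lam -> fill x eta v = x v.
Proof. by move=> vL; rewrite ffunE insubN. Qed.

Lemma inner_fill x eta : inner (fill x eta) = eta.
Proof. by apply/ffunP => w; rewrite ffunE (@fill_in _ _ _ w). Qed.

Lemma agree_fill x eta : agree block x (fill x eta).
Proof. by apply/agreeP => v; rewrite inE => vL; rewrite fill_out. Qed.

Lemma fill_inner x y : agree block x y -> fill x (inner y) = y.
Proof.
move=> /agreeP xy; apply/ffunP => v; have [vL|vL] := boolP (val v \in Lam).
  rewrite (@fill_in _ _ _ [` vL]) // ffunE; congr (y _); exact: val_inj.
by rewrite fill_out // xy // inE.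
Qed.

Lemma sum_fiber x (F : {ffun V -> 'I_q} -> R) :
  \sum_(y | agree block x y) F y = \sum_eta F (fill x eta).
Proof.
rewrite (reindex_onto (fill x) inner) => [|y xy]; last exact: fill_inner.
by apply: eq_bigl => eta; rewrite agree_fill inner_fill eqxx.
Qed.

Lemma weight_fill x eta : weight S tau (fill x eta) =
  weight S (induced_bc x) eta * total_weight (V `\` Lam) (domf tau) (extend x).
Proof.
rewrite weight_extend (total_weight_split _ sub) //; congr (_ * _).
  rewrite (@weightE _ _ eta (extend (fill x eta))) // => [w|v].
    have -> : val w = val (fincl sub w) by [].
    by rewrite extend_in (@fill_in _ _ _ w).
  rewrite ffunE; have := valP v; rewrite !inE /= => /andP[_ /andP[vL _]].
  have [vV|vV] := boolP (val v \in V); last exact: extend_out.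
  have -> : val v = val [` vV] by [].
  by rewrite !extend_in fill_out.
have E u : u \notin Lam -> extend (fill x eta) u = extend x u.
  move=> uL; have [uV|uV] := boolP (u \in V); last exact: extend_out.
  have -> : u = val [` uV] by [].
  by rewrite !extend_in fill_out.
have inO u : u \in V `\` Lam -> u \notin Lam by rewrite !inE => /andP[].
rewrite /total_weight; congr (_ * _ * _); apply: eq_fbigr => u /inO uL _.
- by apply: eq_fbigr => v /inO vL _; rewrite !E.
- apply: eq_fbigr => v vD _; rewrite !E //.
  by apply: contra (tau_out vD); exact: (fsubsetP sub).
- by rewrite E.
Qed.

Lemma inner_weight_gt0 x : 0 < mu x ->
  0 < total_weight (V `\` Lam) (domf tau) (extend x) /\
  0 < partition_function S Lam (induced_bc x).
Proof.
move=> x0; have := weight_gt0 x0.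
rewrite -{1}(fill_inner (agree_refl block x)) weight_fill.
have w0 := weight_ge0 (induced_bc x) (inner x).
have t0 := total_weight_ge0 (V `\` Lam) (domf tau) (extend x).
move=> p0.
have t1 : 0 < total_weight (V `\` Lam) (domf tau) (extend x).
  rewrite lt_neqAle t0 andbT; apply: contraTneq p0 => <-.
  by rewrite mulr0 ltxx.
split=> //; rewrite pmulr_lgt0 // in p0.
rewrite /partition_function (bigD1 (inner x)) //= ltr_pwDl //.
by apply: sumr_ge0 => y _; exact: weight_ge0.
Qed.

Lemma induced_boundary x : 0 < mu x -> boundary_condition S Lam (induced_bc x).
Proof.
move=> x0; split; last by have [] := inner_weight_gt0 x0.
by move=> v; rewrite !inE /= => /andP[].
Qed.

(** In [weight_fill] the weight of the outside of [Lam] is constant on the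
    fibre of [x], so it cancels. *)
Lemma cexp_gibbs f x : 0 < mu x ->
  cexp mu block f x = \sum_eta gibbs S (induced_bc x) eta * f (fill x eta).
Proof.
move=> x0; have [c0 Z0] := inner_weight_gt0 x0.
set c := total_weight _ _ _ in c0.
have Z1 : 0 < partition_function S V tau.
  apply: lt_le_trans (weight_gt0 x0) _.
  rewrite /partition_function (bigD1 x) //= lerDl.
  by apply: sumr_ge0 => y _; exact: weight_ge0.
have muE eta : mu (fill x eta) =
    gibbs S (induced_bc x) eta * (partition_function S Lam (induced_bc x) * c /
      partition_function S V tau).
  rewrite /gibbs weight_fill -/c; field.
  by rewrite !gt_eqF.
have massE : fibre_mass mu block x = partition_function S Lam (induced_bc x) * c /
      partition_function S V tau.
  rewrite /fibre_mass sum_fiber; under eq_bigr do rewrite muE.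
  by rewrite -mulr_suml gibbs_sum1 // mul1r.
rewrite /cexp.
transitivity (\sum_(y | agree block x y) mu y / fibre_mass mu block x * f y).
  rewrite [RHS]big_mkcond; apply: eq_bigr => y _; rewrite /kern.
  by case: ifP; rewrite ?mul0r.
rewrite sum_fiber; apply: eq_bigr => eta _; rewrite muE massE mulfK //.
by rewrite gt_eqF // divr_gt0 // mulr_gt0.
Qed.

Lemma induced_eq (x y : {ffun V -> 'I_q}) :
  (forall u : V, boundary Lam (val u) -> x u = y u) ->
  induced_bc x = induced_bc y.
Proof.
move=> xy; apply/fmapP => v; have [vB|vB] := boolP (v \in bdry); last first.
  by rewrite !not_fnd.
rewrite !in_fnd !ffunE /=; congr Some.
have [vV|vV] := boolP (v \in V); last exact: extend_out.
have -> : v = val [` vV] by [].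
rewrite !extend_in; apply: xy.
by move: vB; rewrite !inE => /andP[].
Qed.

End GibbsMarkov.

(** * Boxes in the lattice *)

Section Geometry.
Variables (R : realType) (d : nat).
Notation site := (site d).
Local Open Scope fset_scope.

Definition site_coord (u : site) (i : 'I_d) : int := u 0%R i.

Definition reaches (u v : site) := exists2 p, path (@adj d) u p & last u p = v.

Lemma reaches_trans u v w : reaches u v -> reaches v w -> reaches u w.
Proof.
move=> [p up pv] [p' vp' <-]; exists (p ++ p'); last by rewrite last_cat pv.
by rewrite cat_path up pv.
Qed.

Lemma reaches_adj u v : adj u v -> reaches u v.
Proof. by move=> uv; exists [:: v]; rewrite //= uv. Qed.

Lemma next_site_delta (u : site) i : next_site u (u + delta_mx 0 i)%R.
Proof. by apply/existsP; exists i. Qed.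

Lemma reaches_axis (z : int) u i : reaches u (u + z *: delta_mx 0 i)%R.
Proof.
elim/int_rec: z u => [|n IHn|n IHn] u.
- by rewrite scale0r addr0; exists [::].
- rewrite intS (addrC (1 : int)) scalerDl scale1r addrA.
  by apply: reaches_trans (IHn u) _; apply: reaches_adj; rewrite /adj next_site_delta.
- rewrite intS (addrC (1 : int)) opprD scalerDl scaleN1r addrA.
  apply: reaches_trans (IHn u) _; apply: reaches_adj; rewrite /adj; apply/orP; right.
  by rewrite -[X in next_site _ X](subrK (delta_mx 0 i)) next_site_delta.
Qed.

(** The infimum that defines [dist_to] is taken over a nonempty set of lengths
    only because every two sites are joined by a path. *)
Lemma lattice_connected u v : reaches u v.
Proof.
rewrite -[v](subrK u) addrC (row_sum_delta (v - u)%R).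
move: (v - u)%R => w; elim: (index_enum _) u => [|i r IHr] u.
  by rewrite big_nil addr0; exists [::].
by rewrite big_cons addrA; apply: reaches_trans (IHr _); exact: reaches_axis.
Qed.

Lemma adj_coord (u v : site) i : adj u v -> (`|site_coord v i - site_coord u i| <= 1)%N.
Proof.
by case/orP => /existsP[j /eqP ->]; rewrite /site_coord !mxE eqxx /=; case: (_ == _) => /=; lia.
Qed.

Lemma path_coord u p i : path (@adj d) u p ->
  (`|site_coord (last u p) i - site_coord u i| <= size p)%N.
Proof.
elim: p u => [|w p IHp] u /=; first by rewrite subrr.
by case/andP => /(adj_coord i) uw /IHp; lia.
Qed.

Lemma dist_to_ge (u v : site) (l : nat) i : (l <= `|site_coord v i - site_coord u i|)%N ->
  l%:R <= dist_to R u [fset v].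
Proof.
move=> lv; apply: lb_le_inf.
  have [p up pv] := lattice_connected u v.
  by exists (size p)%:R; exists p => //=; rewrite up pv fset11.
move=> _ [p /= /andP[up +] <-]; rewrite inE => /eqP pv.
by rewrite ler_nat; apply: leq_trans lv _; rewrite -pv; exact: path_coord.
Qed.

Lemma card_window (V : {fset site}) (A : {set V}) (a : 'I_d -> int) m : (0 < m)%N ->
  (forall u, u \in A -> forall i, (a i <= site_coord (val u) i < a i + m%:Z)%R) ->
  (#|A| <= m ^ d)%N.
Proof.
case: m => // m _ h.
pose f (u : V) : {ffun 'I_d -> 'I_m.+1} := [ffun i => inord `|site_coord (val u) i - a i|].
have fi : {in A &, injective f}.
  move=> u v uA vA /ffunP fuv; apply/val_inj/matrixP => j i; rewrite (ord1 j).
  rewrite -[LHS]/(site_coord (val u) i) -[RHS]/(site_coord (val v) i).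
  move: (fuv i) (h u uA i) (h v vA i); rewrite !ffunE => /(congr1 val) /=.
  move=> E hu hv; rewrite !inordK in E; lia.
rewrite -(card_in_imset fi); apply: leq_trans (max_card _) _.
by rewrite card_ffun !card_ord.
Qed.

Variables (V : {fset site}) (a : site) (m l : nat).

Definition lo (v : site) i : int := Num.max (site_coord a i) (site_coord v i - l%:Z)%R.
Definition hi (v : site) i : int := Num.min (site_coord a i + m%:Z)%R (site_coord v i + l%:Z)%R.

Lemma loP v i : (site_coord a i <= lo v i)%R /\ (site_coord v i - l%:Z <= lo v i)%R /\
  (lo v i = site_coord a i \/ lo v i = (site_coord v i - l%:Z)%R).
Proof. by rewrite /lo; case: leP => h; split=> //; lia. Qed.

Lemma hiP v i : (hi v i <= site_coord a i + m%:Z)%R /\ (hi v i <= site_coord v i + l%:Z)%R /\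
  (hi v i = (site_coord a i + m%:Z)%R \/ hi v i = (site_coord v i + l%:Z)%R).
Proof. by rewrite /hi; case: leP => h; split=> //; lia. Qed.

(** The box of radius [l] around [v], cut off at the sides of the cube: every
    site of the cube outside of it is at distance at least [l] from [v]. *)
Definition box (v : site) : {fset site} :=
  [fset u in V | [forall i, (lo v i <= site_coord u i) && (site_coord u i < hi v i)]]%R.

Definition window (v : V) : {set V} :=
  [set u : V | [forall i, (`|site_coord (val u) i - site_coord (val v) i| <= l.+1)%N]]%SET.

Lemma box_sub v : box v `<=` V.
Proof. by apply/fsubsetP => u; rewrite !inE => /andP[]. Qed.

Lemma boxP v (u : V) : (val u \in box v) =
  [forall i, (lo v i <= site_coord (val u) i)%R && (site_coord (val u) i < hi v i)%R].
Proof. by rewrite !inE /= (valP u). Qed.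

Lemma box_window (v u : V) : val u \in box (val v) -> u \in window v.
Proof.
rewrite boxP => /forallP h; rewrite inE; apply/forallP => i.
by move: (h i) (loP (val v) i) (hiP (val v) i); lia.
Qed.

Lemma box_neighbor_window (v u w : V) : val u \in box (val v) ->
  adj (val u) (val w) -> w \in window v.
Proof.
rewrite boxP => /forallP h uw; rewrite inE; apply/forallP => i.
by move: (h i) (adj_coord i uw) (loP (val v) i) (hiP (val v) i); lia.
Qed.

Lemma card_window_le (v : V) : (#|window v| <= (2 * l + 3) ^ d)%N.
Proof.
apply: (@card_window _ _ (fun i => site_coord (val v) i - l.+1%:Z)%R).
  by rewrite addn_gt0 orbT.
have key (x y : int) : (`|x - y| <= l.+1)%N ->
    (y - l.+1%:Z <= x < y - l.+1%:Z + (2 * l + 3)%N%:Z)%R by lia.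
by move=> u; rewrite inE => /forallP h i; exact: key.
Qed.

Hypothesis Vcube : is_rectangle a (fun=> m) V.

Lemma cube_coord (v : V) i : (site_coord a i <= site_coord (val v) i < site_coord a i + m%:Z)%R.
Proof. by have := valP v; rewrite Vcube => /forallP/(_ i). Qed.

Lemma box_far (v u : V) : val u \notin box (val v) ->
  exists i, (l <= `|site_coord (val v) i - site_coord (val u) i|)%N.
Proof.
rewrite boxP negb_forall => /existsP[i h]; exists i.
by have := cube_coord u i; move: h (loP (val v) i) (hiP (val v) i); lia.
Qed.

Hypothesis l_gt0 : (0 < l)%N.

Lemma box_center (v : V) : val v \in box (val v).
Proof.
rewrite boxP; apply/forallP => i; have := cube_coord v i.
by move: (loP (val v) i) (hiP (val v) i); lia.
Qed.

Lemma box_rectangle (v : V) : is_rectangle (\row_i lo (val v) i)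
  (fun i => `|hi (val v) i - lo (val v) i|%N) (box (val v)).
Proof.
move=> u; rewrite !inE /= Vcube.
have key i : ((site_coord a i <= site_coord u i) && (site_coord u i < site_coord a i + m%:Z) &&
    ((lo (val v) i <= site_coord u i) && (site_coord u i < hi (val v) i)))%R =
    (((\row_i lo (val v) i) 0 i <= site_coord u i) &&
     (site_coord u i < (\row_i lo (val v) i) 0 i + `|hi (val v) i - lo (val v) i|%N%:Z))%R.
  rewrite mxE; have := cube_coord v i; move: (loP (val v) i) (hiP (val v) i).
  by move=> hlo hhi hc; apply/idP/idP; lia.
apply/andP/forallP => [[/forallP h1 /forallP h2] i|h].
  by rewrite -key h1 h2.
by split; apply/forallP => i; move: (h i); rewrite -key => /andP[].
Qed.

Lemma box_sides (v : V) i : (2 * l <= m)%N ->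
  (l <= `|hi (val v) i - lo (val v) i| <= 2 * l)%N.
Proof. by move=> m_ge; have := cube_coord v i; move: (loP (val v) i) (hiP (val v) i); lia. Qed.

End Geometry.

(** * Decay of boundary influence on the centre of a box *)

Section Decay.
Variables (R : realType) (d q : nat) (S : spin_system R q).
Notation site := (site d).
Local Open Scope fset_scope.
Variables (V : {fset site}) (tau : {fmap site -> 'I_q}) (s0 : 'I_q).
Hypothesis tau_out : forall v, v \in domf tau -> v \notin V.
Local Notation mu := (gibbs S tau (L := V)).

Lemma block1 (u : V) : block V [fset val u] = [set u]%SET :> {set V}.
Proof. by apply/setP => v; rewrite !inE val_eqE. Qed.

(** The spatial Markov property for a single vertex: its boundary condition is
    made of its neighbours. *)
Lemma gibbs_law_local (A : {set V}) (u : V) :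
  (forall w : V, adj (val u) (val w) -> w \in A) -> law_local mu A u.
Proof.
move=> uA s x y x0 y0 xy; have sub : [fset val u] `<=` V.
  by apply/fsubsetP => w; rewrite inE => /eqP ->; exact: valP.
rewrite -block1 !(cexp_gibbs s0 tau_out sub) //.
rewrite (@induced_eq _ _ _ _ _ _ x y); last first.
  move=> w; case/andP => _ /existsP[z].
  have := valP z; rewrite inE => /eqP -> /uA wA.
  by move/agreeP: xy; apply; rewrite inE negbK.
have uL : val u \in [fset val u] by exact: fset11.
by apply: eq_bigr => eta _; rewrite !(@fill_in _ _ _ _ _ _ u [` uL]).
Qed.

Lemma tv_marginal (I : finType) (p p' : {ffun I -> 'I_q} -> R) (A : {set I}) w :
  w \in A ->
  \sum_s `|\sum_(eta : {ffun I -> 'I_q} | eta w == s) p eta -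
             \sum_(eta : {ffun I -> 'I_q} | eta w == s) p' eta|
    <= 2 * tv_dist (marginal p (A := A)) (marginal p' (A := A)).
Proof.
move=> wA; rewrite /tv_dist mulrA divff ?mul1r //.
pose w' : {v | v \in A} := exist _ w wA.
have E r s : \sum_(eta : {ffun I -> 'I_q} | eta w == s) r eta =
    \sum_(xi : pinning q A | xi w' == s) marginal r xi.
  rewrite (partition_big (restr A) (fun xi : pinning q A => xi w' == s)); last first.
    by move=> eta; rewrite ffunE.
  apply: eq_bigr => xi /eqP xis; apply: eq_bigl => eta.
  apply: andb_idl => /eqP h; by rewrite -xis -h ffunE.
rewrite [leRHS](partition_big (fun xi : pinning q A => xi w') predT) //=.
apply: ler_sum => s _; rewrite !E -sumrB; exact: ler_norm_sum.
Qed.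

Variables (a : site) (m l L : nat) (alpha gamma : R).
Hypothesis Vcube : is_rectangle a (fun=> m) V.
Hypothesis l_gt0 : (0 < l)%N.
Hypothesis m_ge : (2 * l <= m)%N.
Hypothesis Ll : (L <= l)%N.
Hypothesis alpha_gt0 : 0 < alpha.
Hypothesis gamma_gt0 : 0 < gamma.
Hypothesis ssm :
  forall (l : nat) (a : site) (s : 'I_d -> nat) (Lam B : {fset site}),
      (L <= l)%N -> (forall i, (l <= s i <= 2 * l)%N) ->
      is_rectangle a s Lam -> (B `<=` Lam)%fset ->
    forall (tau tau' : {fmap site -> 'I_q}) (u : site),
      boundary_condition S Lam tau -> boundary_condition S Lam tau' ->
      differ_only_at tau tau' u ->
      let BL := [set v : Lam | val v \in B]%SET in
      tv_dist (marginal (gibbs S tau) (A := BL))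
              (marginal (gibbs S tau') (A := BL))
        <= gamma * expR (- alpha * dist_to R u B).

(** If [u] is not adjacent to the box then the induced boundary conditions are
    equal.  Otherwise they differ at [u] only, at distance at least [l]. *)
Lemma box_decay (v u : V) x y : 0 < mu x -> 0 < mu y ->
  u \notin block V (box V a m l (val v)) -> agree [set u]%SET x y ->
  \sum_c `|cexp mu (block V (box V a m l (val v))) (fun z => (z v == c)%:R) x
           - cexp mu (block V (box V a m l (val v))) (fun z => (z v == c)%:R) y|
    <= 2 * (gamma * expR (- alpha * l%:R)).
Proof.
move=> x0 y0; set Lam := box V a m l (val v); rewrite inE => uL xy.
have sub : Lam `<=` V by exact: box_sub.
have vL : val v \in Lam by exact: box_center.
have lawE z c : 0 < mu z -> cexp mu (block V Lam) (fun z => (z v == c)%:R) z =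
    \sum_(eta : {ffun Lam -> 'I_q} | eta [` vL] == c) gibbs S (induced_bc tau s0 Lam z) eta.
  move=> z0; rewrite (cexp_gibbs s0 tau_out sub) // [RHS]big_mkcond.
  apply: eq_bigr => eta _; rewrite (@fill_in _ _ _ _ _ _ v [` vL]) //.
  by case: eqP; rewrite ?mulr1 ?mulr0.
under eq_bigr do rewrite !lawE //.
have [uB|uB] := boolP (boundary Lam (val u)); last first.
  rewrite (@induced_eq _ _ _ _ _ _ x y); last first.
    move=> w wB; move/agreeP: xy; apply; rewrite inE.
    by apply: contraNneq uB => <-.
  rewrite big1 => [|c _]; last by rewrite subrr normr0.
  by rewrite !mulr_ge0 ?expR_ge0 // ltW.
pose BL := [set w : Lam | val w \in [fset val v]]%SET.
have wB : [` vL] \in BL by rewrite inE fset11.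
apply: le_trans (tv_marginal _ _ wB) _; rewrite ler_wpM2l //.
have vLam : [fset val v] `<=` Lam by apply/fsubsetP => w; rewrite inE => /eqP ->.
have diff : differ_only_at (induced_bc tau s0 Lam x) (induced_bc tau s0 Lam y) (val u).
  split=> //; first by rewrite !inE (valP u).
  move=> w wu; have [wB'|wB'] := boolP (w \in bdry V tau Lam); last first.
    by rewrite !not_fnd.
  rewrite !in_fnd !ffunE /=; congr Some.
  have [wV|wV] := boolP (w \in V); last exact: extend_out.
  have wE : w = val [` wV] by [].
  rewrite {1 2}wE !extend_in; move/agreeP: xy; apply.
  by rewrite inE; apply: contra wu => /eqP <-.
have := @ssm _ _ _ _ _ Ll (fun i => box_sides Vcube l_gt0 v i m_ge)
  (box_rectangle Vcube l_gt0 v) vLam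
  _ _ _ (induced_boundary s0 tau_out sub x0) (induced_boundary s0 tau_out sub y0) diff.
move=> /le_trans; apply.
rewrite ler_pM2l // ler_expR !mulNr lerN2 ler_pM2l //.
have [i li] := box_far Vcube uL.
exact: dist_to_ge li.
Qed.

End Decay.

(** * Choice of the constants *)

Section Constants.
Variable R : realType.

Lemma expr_small (r e : R) : 0 <= r < 1 -> 0 < e -> exists k, r ^+ k <= e.
Proof.
move=> /andP[r0 r1] e0; have r1' : `|r| < 1 by rewrite ger0_norm.
have /cvgr0Pnorm_lt/(_ e e0)[k _ h] := cvg_expr r1'.
exists k; apply: ltW; have := h k (leqnn k).
by rewrite ger0_norm // exprn_ge0.
Qed.

(** With y = alpha / (d + 1), each of [d] factors exp(- y l) absorbs one factor
    2 l + 3, and the last one is at most 1 / (y l). *)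
Lemma scale_exists (c alpha : R) (d L : nat) : 0 <= c -> 0 < alpha ->
  exists l, [/\ (L <= l)%N, (0 < l)%N &
    c * (2 * l + 3)%:R ^+ d * expR (- alpha * l%:R) <= 4^-1].
Proof.
move=> c0 al0; pose y := alpha / d.+1%:R.
have y0 : 0 < y by rewrite divr_gt0.
pose A := c * (5 / y) ^+ d / y.
have A0 : 0 <= A.
  by rewrite /A divr_ge0 ?(ltW y0) // mulr_ge0 // exprn_ge0 // divr_ge0 // ltW.
(* [A / l] will bound the left-hand side, which dictates [l >= 4 A]. *)
pose l := (L + (Num.truncn (4 * A)).+1)%N; exists l; split.
- by rewrite /l leq_addr.
- by rewrite /l addnS.
have l0 : 0 < l%:R :> R by rewrite ltr0n /l addnS.
have lA : 4 * A <= l%:R.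
  have h : 4 * A < (Num.truncn (4 * A)).+1%:R by exact: truncnS_gt.
  apply: ltW (lt_le_trans h _); rewrite ler_nat /l; exact: leq_addl.
set E := expR (- (y * l%:R)).
have E0 : 0 <= E by exact: expR_ge0.
have El : E <= (y * l%:R)^-1.
  rewrite /E expRN lef_pV2 ?posrE ?expR_gt0 ?mulr_gt0 //.
  by apply: le_trans (expR_ge1Dx _); rewrite lerDr.
have EE : expR (- alpha * l%:R) = E ^+ d.+1.
  rewrite /E -expRM_natl; congr expR; rewrite /y; field.
  by rewrite nat1r pnatr_eq0.
have F5 : (2 * l + 3)%:R * E <= 5 / y.
  apply: (@le_trans _ _ ((5 * l)%:R * (y * l%:R)^-1)).
    apply: ler_pM => //; rewrite ?ler0n // ler_nat.
    by move: l0; rewrite ltr0n; lia.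
  rewrite natrM invfM le_eqVlt; apply/orP; left; apply/eqP; field.
  by rewrite !gt_eqF.
have -> : c * (2 * l + 3)%:R ^+ d * expR (- alpha * l%:R) =
    c * ((2 * l + 3)%:R * E) ^+ d * E by rewrite EE exprSr exprMn; ring.
apply: (@le_trans _ _ (c * (5 / y) ^+ d * (y * l%:R)^-1)).
  apply: ler_pM => //.
    by rewrite mulr_ge0 // exprn_ge0 // mulr_ge0.
  apply: ler_wpM2l => //; apply: lerXn2r => //; rewrite nnegrE ?mulr_ge0 //.
  by rewrite invr_ge0 ltW.
rewrite [(y * l%:R)^-1]invfM mulrA -/A ler_pdivrMr //.
by lra.
Qed.

Lemma rounds (n q : nat) : (2 <= n)%N ->
  exists m, (0 < m)%N /\ 2 * (n%:R * (2^-1 ^+ m * q%:R)) <= 4^-1 :> R /\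
    m%:R <= (q + 5)%:R / ln 2 * ln n%:R :> R.
Proof.
move=> n2; have n0 : (0 < n)%N by apply: leq_trans n2.
have ln2 : 0 < ln 2 :> R by rewrite ln_gt0 // ltr1n.
exists (3 + q + (trunc_log 2 n).+1)%N; split; first by rewrite addnS.
split.
  set m := (_ + _)%N; have : (8 * (n * q) <= 2 ^ m)%N.
    rewrite /m !expnD -mulnA leq_mul2l /= mulnC leq_mul //.
      exact/ltnW/ltn_expl.
    by apply: ltnW; exact: trunc_log_ltn.
  rewrite -(ler_nat R) natrX !natrM => h.
  rewrite exprVn (_ : 2 * _ = (8 * (n%:R * q%:R)) * 4^-1 * (2 ^+ m)^-1); last by field.
  by rewrite ler_pdivrMr ?exprn_gt0 // mulrC ler_pM2l.
rewrite mulrAC ler_pdivlMr //.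
have lnn : ln 2 <= ln n%:R :> R by rewrite ler_ln ?posrE ?ltr0n // ler_nat.
have tr : (trunc_log 2 n)%:R * ln 2 <= ln n%:R :> R.
  have h : (2 ^ trunc_log 2 n <= n)%N by exact: trunc_logP.
  rewrite mulr_natl -lnXn // ler_ln ?posrE ?ltr0n ?exprn_gt0 //.
  by rewrite -natrX ler_nat.
rewrite (_ : (3 + q + (trunc_log 2 n).+1)%N = (q + 4 + trunc_log 2 n)%N); last by lia.
rewrite (_ : (q + 5)%N = (q + 4 + 1)%N); last by lia.
rewrite (natrD _ (q + 4) (trunc_log 2 n)) (natrD _ (q + 4) 1) !mulrDl mul1r.
by rewrite lerD // ler_wpM2l.
Qed.

End Constants.

Lemma cube_large (d : nat) (V : {fset site d}) (a : site d) (m l : nat) :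
  is_rectangle a (fun=> m) V -> (0 < l)%N -> ((2 * l) ^ d < #|` V|)%N ->
  (2 * l <= m)%N.
Proof.
move=> Vcube l0 big; rewrite leqNgt; apply/negP => ml.
suff : (#|` V| <= (2 * l) ^ d)%N by rewrite leqNgt big.
rewrite cardfE -cardsT; apply: (@card_window _ _ _ (site_coord a)); first by lia.
move=> u _ i; have := valP u; rewrite Vcube => /forallP/(_ i).
by rewrite -/(site_coord a i) -/(site_coord _ i); lia.
Qed.

Theorem corollary1p9 (R : realType) (d : nat) (hd : (2 <= d)%N)
    (b : R) (hb : 0 < b) (q : nat) (S : spin_system R q)
    (hSSM : strong_spatial_mixing d S) :
  exists (C : R) (N : nat), 0 < C /\
    forall (V : {fset site d}) (tau : {fmap site d -> 'I_q}),
      is_cube V -> boundary_condition S V tau -> (N <= #|` V|)%N ->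
      marginally_bounded (gibbs S tau (L := V)) b ->
      monotone_dist (gibbs S tau (L := V)) ->
      totally_connected (gibbs S tau (L := V)) ->
      forall phi : seq V, perm_eq phi (enum {: V}) ->
        (mixing_time (systematic_scan (gibbs S tau (L := V)) phi)
          <= (C * ln (#|` V|)%:R)%:E)%E.
Proof.
case: hSSM => alpha [gamma [L [al0 ga0 L0 ssm]]].
have qq0 : 0 <= q%:R * (2 * gamma) * q%:R :> R by rewrite !mulr_ge0 // ltW.
have [l [Ll l0 lsmall]] := scale_exists d L qq0 al0.
set M := ((2 * l + 3) ^ d)%N.
(* A bound above 1 would make [1 - p] negative. *)
pose b' := Num.min b 1; have b'0 : 0 < b' by rewrite lt_min hb ltr01.
have b'1 : b' <= 1 by rewrite ge_min lexx orbT.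
pose p := b' ^+ (q * M * (M + M)).
have p0 : 0 < p by rewrite exprn_gt0.
have p1 : p <= 1 by rewrite exprn_ile1 // ltW.
pose e : R := (8 * (q%:R * q%:R * M%:R) + 1)^-1.
have e1 : 0 < 8 * (q%:R * q%:R * M%:R) + 1 :> R by rewrite ltr_wpDl // !mulr_ge0.
have e0 : 0 < e by rewrite invr_gt0.
have [|k0 k0e] := @expr_small R (1 - p) e _ e0; first by rewrite subr_ge0 p1 ltrBlDr ltrDl.
pose k := k0.+1.
have ke : (1 - p) ^+ k <= e.
  apply: le_trans k0e; rewrite /k exprS ler_piMl ?exprn_ge0 ?subr_ge0 //.
  by rewrite lerBlDr lerDl ltW.
pose delta := 2 * (gamma * expR (- alpha * l%:R)).
have delta0 : 0 <= delta by rewrite !mulr_ge0 ?expR_ge0 // ltW.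
have small : (2 * ((1 - p) ^+ k * q%:R) + q%:R * delta) * q%:R * M%:R <= 2^-1.
  have s1 : q%:R * delta * q%:R * M%:R <= 4^-1.
    by apply: le_trans lsmall; rewrite /delta /M natrX le_eqVlt; apply/orP; left; apply/eqP; ring.
  have s2 : 2 * ((1 - p) ^+ k * q%:R) * q%:R * M%:R <= 4^-1.
    apply: (@le_trans _ _ (e * (2 * (q%:R * q%:R * M%:R)))).
      rewrite (_ : 2 * _ * _ * _ = (1 - p) ^+ k * (2 * (q%:R * q%:R * M%:R))); last by ring.
      by rewrite ler_wpM2r // !mulr_ge0.
    rewrite /e mulrC ler_pdivrMr //.
    have : 0 <= q%:R * q%:R * M%:R :> R by rewrite !mulr_ge0.
    lra.
  rewrite (_ : _ * _ = 2 * ((1 - p) ^+ k * q%:R) * q%:R * M%:R + q%:R * delta * q%:R * M%:R);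
    last by ring.
  lra.
pose T0 := (k * (q * M))%N.
exists (T0%:R * ((q + 5)%:R / ln 2) + 1), ((2 * l) ^ d + 2)%N; split.
  by rewrite ltr_wpDl // !mulr_ge0 // invr_ge0 ln_ge0 // ler1n.
move=> V tau [a [m Vcube]] [taub Z0] Vbig mb md tc phi phiP.
have n2 : (2 <= #|` V|)%N by apply: leq_trans Vbig; rewrite leq_addl.
have ml : (2 * l <= m)%N.
  apply: (cube_large Vcube l0); apply: leq_trans Vbig.
  by rewrite -addn1 leq_add2l.
have tau_out v : v \in domf tau -> v \notin V by move=> /taub /andP[].
have [x _ wx] := sum_gt0_exists Z0.
have /fset0Pn[v0 v0V] : V != fset0 by rewrite -cardfs_gt0; exact: leq_trans n2.
pose s0 : 'I_q := x [` v0V]%fset.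
have q0 : (0 < q)%N by apply: leq_ltn_trans (ltn_ord s0).
have M0 : (0 < M)%N by rewrite expn_gt0 addn_gt0 orbT.
have mb' : marginally_bounded (gibbs S tau (L := V)) b'.
  move=> A t v s tf vA h; apply: le_trans (mb A t v s tf vA h).
  by rewrite ge_min lexx.
have [r [r0 [rsmall rln]]] := @rounds R #|` V| q n2.
have mix := @scan_mixing R V q (gibbs S tau (L := V)) (@gibbs_ge0 R d q S V tau)
  (gibbs_sum1 Z0) b' p delta phi (fun v => block V (box V a m l (val v)))
  (window l) M k r.
have {}mix := mix _ mb' md tc phiP.
apply: (@le_trans _ _ ((r * T0)%N%:R)%:E).
  apply: ereal_inf_lbound; exists (r * T0)%N => //; split.
    by rewrite /= !muln_gt0 r0 q0 M0.
  apply: le_trans (mix _ _ _ _ _ _ _ _ small) _ => //.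
  - by rewrite (ltW b'0).
  - by move=> v; rewrite inE; exact: (box_center Vcube l0).
  - move=> v; apply/fintype.subsetP => u; rewrite inE; exact: box_window.
  - by move=> v; exact: card_window_le.
  - move=> v u; rewrite inE => uB; apply: (gibbs_law_local s0 tau_out) => w.
    exact: (box_neighbor_window uB).
  - move=> v x1 x2 u x10 x20 uD x12.
    exact: (box_decay s0 tau_out Vcube l0 ml Ll al0 ga0 ssm x10 x20 uD x12).
  - by move: rsmall; rewrite cardfE.
rewrite lee_fin natrM mulrDl mul1r ler_wpDr //.
  by rewrite ln_ge0 // ler1n; exact: leq_trans n2.
by rewrite mulrC -mulrA ler_wpM2l.
Qed.
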